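(* Let $(R,\mathfrak m)$ be a noetherian local domain of prime characteristic. Then: (i) for any radical ideal $\mathfrak a$ of $R^\infty$, the module $R^\infty/\mathfrak a$ has a free resolution by countably generated free $R^\infty$-modules of length bounded by $2\dim(R)$; (ii) for any radical ideal $\mathfrak a$ of $R^\infty$, the module $R^\infty/\mathfrak a$ has a flat resolution by countably generated flat $R^\infty$-modules of length bounded by $\dim(R)$.
   Context: For a ring $R$ of prime characteristic $p$ with Frobenius map $F:R\to R$, $x\mapsto x^p$, the perfect closure is $R^\infty=\varinjlim(R\xrightarrow{F}R\xrightarrow{F}\cdots)$. $\dim$ is Krull dimension. *)

(* Defs.v *)
From HB Require Import structures.
From mathcomp Require Import all_boot all_order all_algebra.
From mathcomp.classical Require Import boolp.
From mathcomp Require Import zify.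

Set Implicit Arguments.
Unset Strict Implicit.
Unset Printing Implicit Defensive.

Import GRing.Theory.

Local Open Scope ring_scope.
Local Open Scope quotient_scope.

(* A pair (n, x) stands for the image in the colimit of the element x of the
   n-th copy of R, i.e. for x^(1/p^n); two pairs are identified when they have
   the same image in some common later copy. *)
Section PerfectClosure.
Variables (R : comNzRingType) (p : nat) (charRp : p \in [pchar R]).

Local Notation F := (pFrobenius_aut charRp).

Fact iter_FrobD k x y : iter k F (x + y) = iter k F x + iter k F y.
Proof. by elim: k => //= k ->; rewrite rmorphD. Qed.

Fact iter_FrobM k x y : iter k F (x * y) = iter k F x * iter k F y.
Proof. by elim: k => //= k ->; rewrite rmorphM. Qed.

Fact iter_FrobN k x : iter k F (- x) = - iter k F x.
Proof. by elim: k => //= k ->; rewrite rmorphN. Qed.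

Fact iter_Frob0 k : iter k F 0 = 0.
Proof. by elim: k => //= k ->; rewrite rmorph0. Qed.

Fact iter_Frob1 k : iter k F 1 = 1.
Proof. by elim: k => //= k ->; rewrite rmorph1. Qed.

Definition pc_meet (u v : nat * R) : Prop :=
  exists k l, (u.1 + k = v.1 + l)%N /\ iter k F u.2 = iter l F v.2.

Definition pc_rel (u v : nat * R) : bool := `[< pc_meet u v >].

Fact pc_rel_equiv : equiv_class_of pc_rel.
Proof.
split=> [u|u v|v u w].
- by apply/asboolP; exists 0%N, 0%N.
- by apply/asboolP/asboolP => -[k [l [e1 e2]]]; exists l, k.
- move=> /asboolP[k [l [e1 e2]]] /asboolP[k' [l' [e3 e4]]].
  apply/asboolP; exists (k' + k)%N, (l + l')%N; split; first by lia.
  by rewrite iterD e2 -iterD addnC iterD e4 -iterD.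
Qed.

Canonical pc_rel_equivRel := EquivRelPack pc_rel_equiv.
Canonical pc_rel_encModRel := defaultEncModRel pc_rel.

Definition perfect_closure := {eq_quot pc_rel}.

HB.instance Definition _ := Choice.on perfect_closure.
HB.instance Definition _ : EqQuotient (nat * R)%type pc_rel perfect_closure :=
  EqQuotient.on perfect_closure.

Definition pc_in (n : nat) (x : R) : perfect_closure :=
  \pi_perfect_closure (n, x).

Fact pc_in_eq n x m y : pc_in n x = pc_in m y <-> pc_meet (n, x) (m, y).
Proof.
split=> [/eqP|/asboolP uv]; first by rewrite eqmodE => /asboolP.
by apply/eqP; rewrite eqmodE.
Qed.

Fact pc_in_surj u : exists n x, u = pc_in n x.
Proof. by case: (repr u) (reprK u) => n x <-; exists n, x. Qed.

Fact pc_in_shift k n x : pc_in (n + k) (iter k F x) = pc_in n x.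
Proof. by apply/pc_in_eq; exists 0%N, k; rewrite addn0. Qed.

Fact pc_in_Frob n x : pc_in n.+1 (F x) = pc_in n x.
Proof. by rewrite -(pc_in_shift 1 n x) addn1. Qed.

(* The operation induced by an operation f commuting with F. *)
Definition pc_op2 (f : R -> R -> R) (u v : perfect_closure) :=
  let: (n, x) := repr u in let: (m, y) := repr v in
  pc_in (n + m) (f (iter m F x) (iter n F y)).

Definition pc_opp (u : perfect_closure) :=
  let: (n, x) := repr u in pc_in n (- x).

Fact pc_op2E f n x m y :
  (forall k x y, iter k F (f x y) = f (iter k F x) (iter k F y)) ->
  pc_op2 f (pc_in n x) (pc_in m y) =
    pc_in (n + m) (f (iter m F x) (iter n F y)).
Proof.
move=> fF; rewrite /pc_op2.
have: pc_in n x = \pi_perfect_closure (repr (pc_in n x)) by rewrite reprK.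
have: pc_in m y = \pi_perfect_closure (repr (pc_in m y)) by rewrite reprK.
case: (repr (pc_in n x)) => n' x'; case: (repr (pc_in m y)) => m' y'.
move=> /pc_in_eq[/= k' [l' [e3 e4]]] /pc_in_eq[/= k [l [e1 e2]]].
apply/pc_in_eq; exists (l + l')%N, (k + k')%N => /=; split; first by lia.
rewrite !fF -!iterD; congr f.
  rewrite (_ : l + l' + m' = (l' + m') + l)%N; last by lia.
  by rewrite iterD -e2 -iterD; congr iter; lia.
rewrite (_ : l + l' + n' = (l + n') + l')%N; last by lia.
by rewrite iterD -e4 -iterD; congr iter; lia.
Qed.

Fact pc_op2_same f n x y :
  (forall k x y, iter k F (f x y) = f (iter k F x) (iter k F y)) ->
  pc_op2 f (pc_in n x) (pc_in n y) = pc_in n (f x y).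
Proof. by move=> fF; rewrite pc_op2E // -fF pc_in_shift. Qed.

Fact pc_oppE n x : pc_opp (pc_in n x) = pc_in n (- x).
Proof.
rewrite /pc_opp.
have: pc_in n x = \pi_perfect_closure (repr (pc_in n x)) by rewrite reprK.
case: (repr (pc_in n x)) => [n' x'] /pc_in_eq[/= k [l [e1 e2]]].
by apply/pc_in_eq; exists l, k; rewrite /= !iter_FrobN e2.
Qed.

Fact pc_in2 u v : exists n x y, u = pc_in n x /\ v = pc_in n y.
Proof.
have [n [x ->]] := pc_in_surj u; have [m [y ->]] := pc_in_surj v.
exists (n + m)%N, (iter m F x), (iter n F y).
by rewrite pc_in_shift addnC pc_in_shift.
Qed.

Fact pc_in3 u v w :
  exists n x y z, [/\ u = pc_in n x, v = pc_in n y & w = pc_in n z].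
Proof.
have [n [x [y [-> ->]]]] := pc_in2 u v; have [m [z ->]] := pc_in_surj w.
exists (n + m)%N, (iter m F x), (iter m F y), (iter n F z).
by rewrite !pc_in_shift addnC pc_in_shift.
Qed.

Let addE n x y := @pc_op2_same +%R n x y iter_FrobD.
Let mulE n x y := @pc_op2_same *%R n x y iter_FrobM.

Fact pc_in_cst n x : (forall k, iter k F x = x) -> pc_in n x = pc_in 0 x.
Proof. by move=> Fx; rewrite -(pc_in_shift n 0) Fx add0n. Qed.

Fact pc_addA : associative (pc_op2 +%R).
Proof.
move=> u v w; have [n [x [y [z [-> -> ->]]]]] := pc_in3 u v w.
by rewrite !addE addrA.
Qed.

Fact pc_addC : commutative (pc_op2 +%R).
Proof.
by move=> u v; have [n [x [y [-> ->]]]] := pc_in2 u v; rewrite !addE addrC.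
Qed.

Fact pc_add0 : left_id (pc_in 0 0) (pc_op2 +%R).
Proof.
move=> u; have [n [x ->]] := pc_in_surj u.
by rewrite -(pc_in_cst n) ?addE ?add0r // => k; apply: iter_Frob0.
Qed.

Fact pc_addN : left_inverse (pc_in 0 0) pc_opp (pc_op2 +%R).
Proof.
move=> u; have [n [x ->]] := pc_in_surj u.
by rewrite pc_oppE addE addNr pc_in_cst // => k; apply: iter_Frob0.
Qed.

HB.instance Definition _ :=
  GRing.isZmodule.Build perfect_closure pc_addA pc_addC pc_add0 pc_addN.

Fact pc_mulA : associative (pc_op2 *%R).
Proof.
move=> u v w; have [n [x [y [z [-> -> ->]]]]] := pc_in3 u v w.
by rewrite !mulE mulrA.
Qed.

Fact pc_mulC : commutative (pc_op2 *%R).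
Proof.
by move=> u v; have [n [x [y [-> ->]]]] := pc_in2 u v; rewrite !mulE mulrC.
Qed.

Fact pc_mul1 : left_id (pc_in 0 1) (pc_op2 *%R).
Proof.
move=> u; have [n [x ->]] := pc_in_surj u.
by rewrite -(pc_in_cst n) ?mulE ?mul1r // => k; apply: iter_Frob1.
Qed.

Fact pc_mulDl : left_distributive (pc_op2 *%R) +%R.
Proof.
move=> u v w; have [n [x [y [z [-> -> ->]]]]] := pc_in3 u v w.
by rewrite [_ + _]addE [LHS]mulE mulrDl !mulE [RHS]addE.
Qed.

Fact pc_one_neq0 : pc_in 0 1 != 0.
Proof.
apply/eqP => /pc_in_eq[k [l [_]]] /=; rewrite iter_Frob0 iter_Frob1.
exact/eqP/oner_neq0.
Qed.

HB.instance Definition _ := GRing.Zmodule_isComNzRing.Build perfect_closure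
  pc_mulA pc_mulC pc_mul1 pc_mulDl pc_one_neq0.

Fact pc_in_is_zmod_morphism n : zmod_morphism (pc_in n).
Proof. by move=> x y; rewrite -addE; congr (_ + _); rewrite -pc_oppE. Qed.

Fact pc_in_is_monoid_morphism n : monoid_morphism (pc_in n).
Proof.
split=> [|x y]; first by apply: pc_in_cst => k; apply: iter_Frob1.
by rewrite -mulE.
Qed.

HB.instance Definition _ n :=
  GRing.isZmodMorphism.Build R perfect_closure (pc_in n)
    (pc_in_is_zmod_morphism n).
HB.instance Definition _ n :=
  GRing.isMonoidMorphism.Build R perfect_closure (pc_in n)
    (pc_in_is_monoid_morphism n).

End PerfectClosure.

Section QuotientModule.
Variables (A : nzRingType) (V : lmodType A) (S : submodClosed V).

(* ssralg does not make a submodClosed a zmodClosed, as it is also meant for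
   semimodules. *)
Definition submod_pred (v : V) : bool := v \in S.

Fact submod_pred_zmod_closed : zmod_closed submod_pred.
Proof.
by split=> [|u v uS vS]; rewrite ?rpred0 // -scaleN1r rpredD // rpredZ.
Qed.

HB.instance Definition _ :=
  GRing.isZmodClosed.Build V submod_pred submod_pred_zmod_closed.

Local Notation Q := (Quotient.quot (GRing.ZmodClosed.clone V submod_pred _)).

Definition quot_mod : Type := Q.

HB.instance Definition _ := GRing.Zmodule.on quot_mod.

Definition quot_proj (v : V) : quot_mod := \pi_Q v.

Definition quot_scale (a : A) (u : quot_mod) : quot_mod :=
  quot_proj (a *: repr (u : Q)).

Fact quot_proj_eq u v : quot_proj u = quot_proj v <-> u - v \in S.
Proof.
by split=> [/eqP|uv]; [rewrite eqmodE | apply/eqP; rewrite eqmodE].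
Qed.

Fact quot_proj_surj u : exists v, u = quot_proj v.
Proof. by exists (repr (u : Q)); rewrite /quot_proj reprK. Qed.

Fact quot_projD u v : quot_proj (u + v) = quot_proj u + quot_proj v.
Proof. exact: (raddfD (\pi_Q)). Qed.

Fact quot_scaleE a v : quot_scale a (quot_proj v) = quot_proj (a *: v).
Proof.
apply/quot_proj_eq; rewrite -scalerBr rpredZ //.
by apply/quot_proj_eq; rewrite /quot_proj reprK.
Qed.

Fact quot_scaleA a b u : quot_scale a (quot_scale b u) = quot_scale (a * b) u.
Proof. by have [v ->] := quot_proj_surj u; rewrite !quot_scaleE scalerA. Qed.

Fact quot_scale1 : left_id 1 quot_scale.
Proof.
by move=> u; have [v ->] := quot_proj_surj u; rewrite quot_scaleE scale1r.
Qed.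

Fact quot_scaleDr : right_distributive quot_scale +%R.
Proof.
move=> a u v; have [x ->] := quot_proj_surj u; have [y ->] := quot_proj_surj v.
by rewrite -quot_projD !quot_scaleE scalerDr quot_projD.
Qed.

Fact quot_scaleDl u : {morph quot_scale^~ u : a b / a + b}.
Proof.
move=> a b; have [x ->] := quot_proj_surj u.
by rewrite !quot_scaleE scalerDl quot_projD.
Qed.

HB.instance Definition _ := GRing.Zmodule_isLmodule.Build A quot_mod
  quot_scaleA quot_scale1 quot_scaleDr quot_scaleDl.

Fact quot_proj_is_linear : linear quot_proj.
Proof. by move=> a u v; rewrite quot_projD -quot_scaleE. Qed.

HB.instance Definition _ :=
  GRing.isLinear.Build A V quot_mod *:%R quot_proj quot_proj_is_linear.

End QuotientModule.

(* Unlike ring_quotient's idealr, the unit ideal is allowed. *)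
Notation ideal A := (submodClosed A^o).

Definition radical_ideal (A : comNzRingType) (I : ideal A) : Prop :=
  forall (x : A) (n : nat), x ^+ n \in I -> x \in I.

Definition noetherian (A : comNzRingType) : Prop :=
  forall I : ideal A, exists s : seq A, forall x : A,
    x \in I <-> exists c : 'I_(size s) -> A, x = \sum_(i < size s) c i * s`_i.

Definition maximal_ideal (A : comNzRingType) (I : ideal A) : Prop :=
  (1 : A) \notin I /\
  forall J : ideal A, {subset I <= J} -> (1 : A) \notin J -> I =i J.

Definition local_ring (A : comNzRingType) (m : ideal A) : Prop :=
  maximal_ideal m /\ forall J : ideal A, maximal_ideal J -> J =i m.

Definition prime_chain (A : comNzRingType) (n : nat)
    (c : 'I_n.+1 -> prime_idealr A) : Prop :=
  forall i j : 'I_n.+1, (i < j)%N ->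
    {subset c i <= c j} /\ ~ {subset c j <= c i}.

Definition krull_dim (A : comNzRingType) (d : nat) : Prop :=
  (exists c : 'I_d.+1 -> prime_idealr A, prime_chain c) /\
  forall n (c : 'I_n.+1 -> prime_idealr A), prime_chain c -> (n <= d)%N.

Definition countably_generated (A : nzRingType) (M : lmodType A) : Prop :=
  exists g : nat -> M, forall x : M,
    exists (n : nat) (c : nat -> A), x = \sum_(i < n) c i *: g i.

Definition free_mod (A : nzRingType) (M : lmodType A) : Prop :=
  exists (I : eqType) (b : I -> M),
    (forall x : M, exists (s : seq I) (c : I -> A),
       x = \sum_(i <- s) c i *: b i) /\
    (forall (s : seq I) (c : I -> A), uniq s ->
       \sum_(i <- s) c i *: b i = 0 -> forall i, i \in s -> c i = 0).

(* The formal sum [:: (x_1, y_1); ...; (x_n, y_n)] stands for the element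
   x_1 (x) y_1 + ... + x_n (x) y_n of the tensor product of M and N over A,
   which is the quotient of the formal sums by this congruence; it is a group,
   the opposite of x (x) y being (- x) (x) y. *)
Inductive tensor_eq (A : comNzRingType) (M N : lmodType A) :
    seq (M * N) -> seq (M * N) -> Prop :=
| tensor_refl s : tensor_eq s s
| tensor_sym s t : tensor_eq s t -> tensor_eq t s
| tensor_trans s t u : tensor_eq s t -> tensor_eq t u -> tensor_eq s u
| tensor_cat s s' t t' :
    tensor_eq s s' -> tensor_eq t t' -> tensor_eq (s ++ t) (s' ++ t')
| tensor_catC s t : tensor_eq (s ++ t) (t ++ s)
| tensor_0l y : tensor_eq [:: (0, y)] [::]
| tensor_Dl x x' y : tensor_eq [:: (x + x', y)] [:: (x, y); (x', y)]
| tensor_Dr x y y' : tensor_eq [:: (x, y + y')] [:: (x, y); (x, y')]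
| tensor_Z a x y : tensor_eq [:: (a *: x, y)] [:: (x, a *: y)].

(* M (x) f is injective for every injective f. *)
Definition flat_mod (A : comNzRingType) (M : lmodType A) : Prop :=
  forall (N N' : lmodType A) (f : {linear N -> N'}), injective f ->
  forall s t : seq (M * N),
    tensor_eq [seq (u.1, f u.2) | u <- s] [seq (u.1, f u.2) | u <- t] ->
    tensor_eq s t.

(* An exact sequence ... -> P 1 -> P 0 -> M -> 0. *)
Record resolution (A : nzRingType) (M : lmodType A) := Resolution {
  res_mod : nat -> lmodType A;
  res_diff : forall i, {linear res_mod i.+1 -> res_mod i};
  res_aug : {linear res_mod 0 -> M};
  res_aug_surj : forall y : M, exists x, res_aug x = y;
  res_exact0 : forall x, res_aug x = 0 <-> exists y, res_diff 0 y = x;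
  res_exact : forall i x, res_diff i x = 0 <-> exists y, res_diff i.+1 y = x
}.

Definition res_length_le (A : nzRingType) (M : lmodType A)
    (P : resolution M) (n : nat) : Prop :=
  forall i, (n < i)%N -> forall x : res_mod P i, x = 0.

(* Main.v *)
Require Import Defs.
From HB Require Import structures.
From mathcomp Require Import all_boot all_order all_algebra.
From mathcomp.classical Require Import boolp functions.

Set Implicit Arguments.
Unset Strict Implicit.
Unset Printing Implicit Defensive.

Import GRing.Theory.

(** Write A for the perfect closure of R; it is a domain on which Frobenius is
bijective.  For x in A let I_x be the ideal generated by all the roots
x^(1/p^j).

The number of generators.  In a noetherian local ring of dimension d every
proper ideal is, up to radical, generated by d elements: an element avoiding
the finitely many primes that are minimal over the previous choices, and that do
not contain the ideal, raises by one the height of every prime containing the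
choices but not the ideal; after d steps such a prime would have height at least
d, like the maximal ideal, although it is strictly smaller
([radical_generators]).  A radical ideal of A is determined by
its contraction to R, so a proper one is I_(x_1) + ... + I_(x_d) for elements
x_i of R ([radical_ideal_root_sum]).  The unit ideal has quotient zero.

Adding one generator.  Let a be a radical ideal, M = A/a, and let P be a
resolution of M.  The kernel of M -> A/(a + I_x) is I_x M.  Since a is radical,
x^(1/p^j) m = 0 in M implies x^(1/p^(j+1)) m = 0 ([quot_xi_reduced]), which
says that the tensor product of I_x and M embeds in M, with image I_x M.
Resolutions of I_x M are therefore obtained from P:

- if the P_i are torsion free, their submodules I_x P_i form a resolution of
  I_x M ([xi_res]); each I_x P_i is the union of an increasing sequence of
  copies of P_i, hence flat if P_i is ([flat_xi]);
- writing P_i^(N) for the finitely supported sequences in P_i, the telescope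
  0 -> M^(N) -> M^(N) -> I_x M -> 0 is exact ([tau_inj], [sigma_ker]), and the
  mapping cone of the corresponding endomorphism of P^(N) resolves I_x M.

The mapping cone of the map from such a resolution to P then resolves
A/(a + I_x) ([cone]).  This adds 1 to the length in the flat case ([flat_step])
and 2 in the free case ([free_step]).  Starting from A/0 = A, d generators give
lengths d and 2d. *)

Local Open Scope ring_scope.

(** * Submodules and prime ideals given by propositions *)

Section PropSubmodule.
Variables (A : nzRingType) (V : lmodType A) (S : V -> Prop).

Definition submod_prop : Prop :=
  S 0 /\ forall a u v, S u -> S v -> S (a *: u + v).

Definition submod_bool of submod_prop : V -> bool := fun v => `[< S v >].

Fact submod_bool_closed (h : submod_prop) : submod_closed (submod_bool h).
Proof.
case: (h) => h0 hD; split=> [|a u v /asboolP Su /asboolP Sv].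
  exact/asboolP.
by apply/asboolP/hD.
Qed.

HB.instance Definition _ (h : submod_prop) :=
  GRing.isSubmodClosed.Build A V (submod_bool h) (submod_bool_closed h).

Definition Submod (h : submod_prop) : submodClosed V :=
  GRing.SubmodClosed.clone A V (submod_bool h) _.

Lemma in_Submod (h : submod_prop) v : v \in Submod h <-> S v.
Proof. by split=> [/asboolP|Sv]; [|apply/asboolP]. Qed.

End PropSubmodule.

Section PrimeIdeal.
Variables (A : comNzRingType) (S : A -> bool).
Hypothesis hS : idealr_closed S /\ prime_idealr_closed S.

Definition prime_pred : A -> bool := S.
HB.instance Definition _ := isIdealr.Build A prime_pred hS.1.
HB.instance Definition _ := isPrimeIdealrClosed.Build A prime_pred hS.2.
Definition PrimeIdeal : prime_idealr A := PrimeIdealr.clone A prime_pred _.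
End PrimeIdeal.

(** * Generating ideals of a noetherian local ring up to radical *)

Section NoetherianIdeals.
Variable (R : comNzRingType).
Implicit Types (I J K : ideal R) (P Q : prime_idealr R) (x y : R).

(** An ideal is a submodule of the regular module; the next three lemmas restate
its closure properties with the operations of the ring itself. *)
Lemma ideal_mulr J a x : x \in J -> a * x \in J.
Proof. exact: (@rpredZ _ _ J a x). Qed.

Lemma ideal_0 J : (0 : R) \in J.
Proof. exact: (@rpred0 _ J). Qed.

Lemma ideal_add J x y : x \in J -> y \in J -> x + y \in J.
Proof. exact: (@rpredD _ J x y). Qed.

(** Noetherian induction.  A counterexample would start a strictly increasing
sequence of counterexamples; the finitely many generators of its union all
appear at some finite stage. *)
Lemma noetherian_ind (Phi : ideal R -> Prop) : noetherian R ->
  (forall J, (forall K, {subset J <= K} -> ~ {subset K <= J} -> Phi K) ->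
     Phi J) ->
  forall J, Phi J.
Proof.
move=> noeth step J0; apply: contrapT => nJ0.
pose T := {J | ~ Phi J}.
have next (t : T) : {u : T | {subset sval t <= sval u} /\
                             ~ {subset sval u <= sval t}}.
  apply: cid; case: t => J nJ /=; apply: contrapT => hno.
  apply: nJ; apply: step => K JK nKJ; apply: contrapT => nK.
  by apply: hno; exists (exist _ K nK).
pose c := fix c n : T := if n is k.+1 then sval (next (c k))
  else exist _ J0 nJ0.
have c_mono i j : (i <= j)%N -> {subset sval (c i) <= sval (c j)}.
  move=> /subnK <-; elim: (j - i)%N => [|k IH] x //= xi.
  by have [h _] := svalP (next (c (k + i)%N)); apply/h/IH.
have uP : submod_prop (fun x : R^o => exists n, x \in sval (c n)).
  split=> [|a u v [n un] [k vk]]; first by exists 0%N; apply: rpred0.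
  exists (maxn n k); rewrite rpredD ?rpredZ //.
    by apply: c_mono un; rewrite leq_maxl.
  by apply: c_mono vk; rewrite leq_maxr.
have [s hs] := noeth (Submod uP).
have sU (i : 'I_(size s)) : exists n, s`_i \in sval (c n).
  apply/(in_Submod uP)/hs; exists (fun j => (j == i)%:R).
  rewrite (bigD1 i) //= eqxx mul1r big1 ?addr0 // => j /negbTE ->.
  by rewrite mul0r.
have [f hf] := choice sU.
pose N := \max_(i < size s) f i.
have [_ []] := svalP (next (c N)) => x xN.
have /hs[b ->] : x \in Submod uP by apply/in_Submod; exists N.+1.
rewrite rpred_sum // => i _; apply: ideal_mulr.
by apply: c_mono (hf i); apply: leq_bigmax_cond.
Qed.

Lemma add_ideal_prop J a :
  submod_prop (fun x : R^o => exists j r : R, j \in J /\ x = j + r * a).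
Proof.
split=> [|b u v [j [r [jJ ->]]] [k [t [kJ ->]]]].
  by exists 0, 0; rewrite ideal_0 mul0r addr0.
exists (b * j + k), (b * r + t); split; first by rewrite ideal_add ?ideal_mulr.
have -> : b *: (j + r * a : R^o) = b * (j + r * a) by [].
by rewrite mulrDr mulrDl mulrA !addrA (addrAC _ _ k).
Qed.

Definition add_ideal J a : ideal R := Submod (add_ideal_prop J a).

Lemma in_add_ideal J a x :
  x \in add_ideal J a <-> exists j r, j \in J /\ x = j + r * a.
Proof. exact: (in_Submod (add_ideal_prop J a) x). Qed.

Lemma sub_add_ideal J a : {subset J <= add_ideal J a}.
Proof.
by move=> x xJ; apply/in_add_ideal; exists x, 0; rewrite mul0r addr0.
Qed.

Lemma mem_add_ideal J a : a \in add_ideal J a.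
Proof.
by apply/in_add_ideal; exists 0, 1; rewrite ideal_0 mul1r add0r.
Qed.

Lemma add_ideal_sub_prime J a Q :
  {subset J <= Q} -> a \in Q -> {subset add_ideal J a <= Q}.
Proof.
move=> JQ aQ x /in_add_ideal[j [r [jJ ->]]].
by rewrite rpredD ?idealMr //; apply: JQ.
Qed.

Lemma prime_idealr_of_ideal J : (1 : R) \notin J ->
  (forall a b, a * b \in J -> a \in J \/ b \in J) ->
  exists P, J =i P.
Proof.
move=> J1 Jpr.
have h : idealr_closed (fun x : R => x \in J) /\
         prime_idealr_closed (fun x : R => x \in J).
  split; first split=> //; first exact: ideal_0.
    by move=> a u v uJ vJ; apply: ideal_add => //; apply: ideal_mulr.
  by move=> a b /Jpr[] h; apply/orP; [left|right].
by exists (PrimeIdeal h).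
Qed.

Lemma prime_submod_prop P : submod_prop (fun x : R^o => x \in P).
Proof.
by split=> [|a u v uP vP]; rewrite ?rpred0 // rpredD // idealMr.
Qed.

Definition ideal_of_prime P : ideal R := Submod (prime_submod_prop P).

Lemma in_ideal_of_prime P x : x \in ideal_of_prime P <-> x \in P.
Proof. exact: (in_Submod (prime_submod_prop P) x). Qed.

(** The list Ps contains the minimal primes over J, together with the fact that
their intersection is the radical of J.  If J is neither prime nor the unit
ideal, some a * b lies in J with a, b outside J; concatenating the lists for
J + (a) and J + (b) works, since every prime over J contains a or b and the
product of these two ideals lies in J. *)
Lemma primes_above J : noetherian R ->
  exists Ps : seq (prime_idealr R),
    [/\ forall P, List.In P Ps -> {subset J <= P},
        forall x, (forall P, List.In P Ps -> x \in P) ->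
          exists k, x ^+ k \in J
      & forall Q, {subset J <= Q} ->
          exists P, List.In P Ps /\ {subset P <= Q}].
Proof.
move=> noeth; move: J; apply: (noetherian_ind noeth) => J IH.
have [J1|nJ1] := boolP ((1 : R) \in J).
  exists [::]; split=> // [x _|Q JQ]; first by exists 0%N.
  by have := JQ _ J1; rewrite idealr1.
have [Jpr|] := pselect (forall a b, a * b \in J -> a \in J \/ b \in J).
  have [P JP] := prime_idealr_of_ideal nJ1 Jpr.
  exists [:: P]; split=> [_ [<-|//] x|x h|Q JQ]; first by rewrite JP.
    by exists 1%N; rewrite expr1 JP; apply: h; left.
  by exists P; split; [left | move=> x; rewrite -JP; apply: JQ].
move=> /existsNP[a /existsNP[b /not_implyP[abJ /not_orP[naJ nbJ]]]].
have IHa c : c \notin J -> _ := fun ncJ => IH (add_ideal J c)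
  (@sub_add_ideal J c) (fun h => negP ncJ (h _ (mem_add_ideal J c))).
have [Ps [PsJ Psx PsQ]] := IHa a (introN idP naJ).
have [Qs [QsJ Qsx QsQ]] := IHa b (introN idP nbJ).
exists (Ps ++ Qs); split=> [P|x hx|Q JQ].
- move=> /List.in_app_iff[/PsJ|/QsJ] h x xJ; exact/h/sub_add_ideal.
- have [P hP|k /in_add_ideal[j [r [jJ ej]]]] := Psx x.
    by apply: hx; apply/List.in_app_iff; left.
  have [P hP|l /in_add_ideal[j' [r' [jJ' ej']]]] := Qsx x.
    by apply: hx; apply/List.in_app_iff; right.
  exists (k + l)%N; rewrite exprD ej ej' mulrDl; apply: ideal_add.
    by rewrite mulrC; apply: ideal_mulr.
  rewrite mulrDr; apply: ideal_add; first exact: ideal_mulr.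
  by rewrite mulrACA; apply: ideal_mulr.
- have : a * b \in Q by apply: JQ.
  rewrite prime_idealrM => /orP[aQ|bQ].
    have [P [PPs PQ]] := PsQ Q (add_ideal_sub_prime JQ aQ).
    by exists P; split=> //; apply/List.in_app_iff; left.
  have [P [PPs PQ]] := QsQ Q (add_ideal_sub_prime JQ bQ).
  by exists P; split=> //; apply/List.in_app_iff; right.
Qed.

(** Given x in I avoiding Ps but not P, one adds to x some y in I outside P that
lies in every Q of Ps not contained in P.  The sum avoids P, hence every Q
contained in P, and it avoids the other Q because y lies in them. *)
Lemma prime_avoidance I (Ps : seq (prime_idealr R)) :
  (forall P, List.In P Ps -> ~ {subset I <= P}) ->
  exists2 x, x \in I & forall P, List.In P Ps -> x \notin P.
Proof.
elim: Ps => [|P Ps IH] hPs; first by exists 0; rewrite ?ideal_0.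
have [Q hQ|x xI hx] := IH; first by apply: hPs; right.
have [xP|xP] := boolP (x \in P); last first.
  by exists x => // Q [<-|/hx].
have [y [yI yP hy]] : exists y, [/\ y \in I, y \notin P
    & forall Q, List.In Q Ps -> y \in Q \/ {subset Q <= P}].
  have /existsNP[z /not_implyP[zI /negP zP]] := hPs P (or_introl erefl).
  elim: Ps {IH hPs hx} => [|Q Ps [y [yI yP hy]]]; first by exists z.
  have [QP|] := pselect {subset Q <= P}.
    by exists y; split=> // Q' [<-|/hy //]; right.
  move=> /existsNP[t /not_implyP[tQ /negP tP]].
  exists (y * t); split=> [||Q' [<-|/hy[yQ'|]]].
  - by rewrite mulrC ideal_mulr.
  - by rewrite prime_idealrM negb_or yP.
  - by left; rewrite idealMr.
  - by left; rewrite mulrC idealMr.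
  - by right.
have xyP : x + y \notin P.
  by apply: contra yP => h; rewrite -(addKr x y) rpredD // rpredN.
exists (x + y) => [|Q [<- //|QPs]]; first by rewrite ideal_add.
have [yQ|QP] := hy _ QPs; last by apply: contra xyP; apply: QP.
by apply: contra (hx _ QPs) => h; rewrite -(addrK y x) rpredB.
Qed.

Fixpoint height_ge n P : Prop :=
  if n is k.+1 then
    exists Q, [/\ height_ge k Q, {subset Q <= P} & ~ {subset P <= Q}]
  else True.

Lemma height_ge_chain n P : height_ge n P ->
  exists c : 'I_n.+1 -> prime_idealr R, prime_chain c /\ c ord_max = P.
Proof.
move=> h; suff [c [hc cn]] : exists c : nat -> prime_idealr R,
    (forall i j, (i < j <= n)%N ->
       {subset c i <= c j} /\ ~ {subset c j <= c i}) /\ c n = P.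
  exists c; split=> // i j ij; apply: hc; rewrite ij /=; exact: leq_ord.
elim: n P h => [|n IH] P /= => [_|[Q [/IH[c [hc <-]] QP nPQ]]].
  exists (fun=> P); split=> // i j; by case: j => [|j]; rewrite ?ltn0 ?andbF.
exists (fun i => if (i <= n)%N then c i else P); split; last by rewrite ltnn.
move=> i j /andP[ij]; rewrite leq_eqVlt => /orP[/eqP ej|jn]; last first.
  rewrite (jn : (j <= n)%N) (leq_trans (ltnW ij) (jn : (j <= n)%N)).
  by apply: hc; rewrite ij.
have lin : (i <= n)%N by rewrite -ltnS -ej.
rewrite ej ltnn lin; move: lin; rewrite leq_eqVlt => /orP[/eqP -> //|lin].
have [cin ncin] := hc i n (introT andP (conj lin (leqnn n))).
split=> [x /cin/QP //|Pc]; apply: nPQ => x /Pc; exact: cin.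
Qed.

(** The next generator x is chosen in I outside all primes Q of [primes_above]
for the previous generators that do not contain I.  A prime P over x :: s not
containing I lies over one such Q, and x separates P from Q. *)
Lemma height_generators I n : noetherian R ->
  exists2 s : seq R, size s = n /\ {subset s <= I} &
    forall P, {subset s <= P} -> ~ {subset I <= P} -> height_ge n P.
Proof.
move=> noeth; elim: n => [|n [s [sn sI] hs]]; first by exists [::].
have JP : submod_prop (fun x : R^o =>
    forall K, {subset s <= K} -> x \in K).
  split=> [K _|a u v hu hv K sK]; first exact: rpred0.
  by rewrite rpredD ?rpredZ ?hu ?hv.
have [Ps [PsJ _ PsQ]] := primes_above (Submod JP) noeth.
have Ps_s P : List.In P Ps -> {subset s <= P}.
  by move=> /PsJ h x xs; apply/h/in_Submod => K; apply.
have [Qs [hQs hPQ]] : exists Qs,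
   (forall P, List.In P Qs -> ~ {subset I <= P} ) /\
   (forall P, List.In P Ps -> {subset I <= P} \/ List.In P Qs).
  elim: Ps {PsJ PsQ Ps_s} => [|P Ps [Qs [h1 h2]]]; first by exists [::].
  have [IP|nIP] := pselect {subset I <= P}.
    by exists Qs; split=> // Q [<-|/h2]; [left|].
  exists (P :: Qs); split=> Q [<-//|]; first exact: h1.
    by right; left.
  by move=> /h2[]; [left|right; right].
have [x xI hx] := prime_avoidance hQs.
exists (x :: s).
  by split=> [|y]; rewrite /= ?sn // inE => /orP[/eqP->//|/sI].
move=> P sP nIP.
have xP : x \in P by apply: sP; rewrite mem_head.
have sP' : {subset s <= P} by move=> y ys; apply: sP; rewrite inE ys orbT.
have [|Q [QPs QP]] := PsQ P.
  move=> y /(in_Submod JP) hy; apply/in_ideal_of_prime/hy => z zs.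
  exact/in_ideal_of_prime/sP'.
have nIQ : ~ {subset I <= Q} by move=> IQ; apply: nIP => y /IQ/QP.
exists Q; split=> //; first by apply: hs => //; apply: Ps_s.
by move=> PQ; have [//|/hx/negP] := hPQ Q QPs; apply; apply: PQ.
Qed.

(** A proper ideal with no proper ideal strictly above it is maximal, so
noetherian induction replaces the appeal to Zorn's lemma. *)
Lemma proper_sub_maximal (m : ideal R) J : noetherian R -> local_ring m ->
  (1 : R) \notin J -> {subset J <= m}.
Proof.
move=> noeth [_ lm]; move: J.
apply: (noetherian_ind noeth) => J IH J1.
have [[K [JK nKJ K1]]|hno] := pselect (exists K,
    [/\ {subset J <= K}, ~ {subset K <= J} & (1 : R) \notin K]).
  by move=> x /JK; apply: IH.
suff /lm Jm : maximal_ideal J by move=> x; rewrite Jm.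
split=> // K JK K1 x; apply/idP/idP; first exact: JK.
move: x; apply: contrapT => nKJ; apply: hno; by exists K.
Qed.

(** With n = d, a prime P over s not containing I would have height at least d;
as I is contained in m, the inclusion of P in m would be strict, and m would be
the top of a chain longer than the dimension allows. *)
Theorem radical_generators (m : ideal R) I d :
    noetherian R -> local_ring m -> krull_dim R d -> (1 : R) \notin I ->
  exists2 s : seq R, size s = d /\ {subset s <= I} &
    forall J, radical_ideal J -> {subset s <= J} -> {subset I <= J}.
Proof.
move=> noeth lm [_ dimR] I1.
have [s sI hs] := height_generators I d noeth; exists s => //.
have sP P : {subset s <= P} -> {subset I <= P}.
  move=> sP; apply: contrapT => nIP.
  have Im := proper_sub_maximal noeth lm I1.
  have [[m1 _] _] := lm.
  have Pm : {subset P <= m}.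
    have h1 : (1 : R) \notin ideal_of_prime P.
      by apply/negP => /in_ideal_of_prime; rewrite idealr1.
    move=> x xP; apply: (proper_sub_maximal noeth lm h1).
    exact/in_ideal_of_prime.
  have mpr : forall a b, a * b \in m -> a \in m \/ b \in m.
    move=> a b abm; have [am|am] := boolP (a \in m); first by left.
    right; have [a1|a1] := boolP ((1 : R) \in add_ideal m a).
      have /in_add_ideal[j [r [jm e]]] := a1.
      rewrite -[b]mul1r e mulrDl ideal_add //.
        by rewrite mulrC ideal_mulr.
      by rewrite -mulrA ideal_mulr.
    case/negP: am; apply: (proper_sub_maximal noeth lm a1).
    exact: mem_add_ideal.
  have [M mM] := prime_idealr_of_ideal m1 mpr.
  have /height_ge_chain[c [hc _]] : height_ge d.+1 M.
    exists P; split; first exact: hs.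
      by move=> x /Pm; rewrite mM.
    by move=> MP; apply: nIP => x /Im; rewrite mM => /MP.
  by have := dimR _ _ hc; rewrite ltnn.
move=> J radJ sJ x xI.
have [Ps [PsJ Psx _]] := primes_above J noeth.
have [P PPs|k] := Psx x; last exact: radJ.
by apply: (sP P) xI => y /sJ; apply: PsJ.
Qed.

End NoetherianIdeals.

(** * Mapping cones of resolutions *)

Section SubmoduleType.
Variables (A : nzRingType) (V : lmodType A) (S : submodClosed V).

Definition submod_type : Type := {v : V | v \in S}.
HB.instance Definition _ := SubChoice.on submod_type.
HB.instance Definition _ := [SubChoice_isSubLmodule of submod_type by <:].

Definition insubmod v (vS : v \in S) : submod_type := exist _ v vS.
End SubmoduleType.

Section LinearMaps.
Variables (A : nzRingType) (U V : lmodType A).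

Section Pack.
Variables (f : U -> V).
Definition lin_fun of linear f : U -> V := f.
HB.instance Definition _ (h : linear f) :=
  GRing.isLinear.Build A U V *:%R (lin_fun h) h.
Definition Lin (h : linear f) : {linear U -> V} := lin_fun h.
End Pack.

End LinearMaps.

(** The mapping cone of a chain map f from a resolution Q of N to a resolution P
of M, over an injection g of N in M with cokernel q : M -> C.  If (u, v) is a
cycle of the cone, v is a cycle of Q, hence a boundary, in degree 0 because g is
injective; modifying (u, v) by a boundary reduces to v = 0, and then u is a
cycle of P.  The term of degree i is P_i + Q_(i-1); the missing Q_(-1) is why
degree 0 is treated apart. *)
Section Cone.
Variables (A : nzRingType) (M N C : lmodType A).
Variables (P : resolution M) (Q : resolution N).
Variables (f : forall i, {linear res_mod Q i -> res_mod P i}).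
Variables (g : {linear N -> M}) (q : {linear M -> C}).
Hypothesis f_diff : forall i y, f i (res_diff Q i y) = res_diff P i (f i.+1 y).
Hypothesis f_aug : forall y, g (res_aug Q y) = res_aug P (f 0 y).
Hypothesis g_inj : forall y, g y = 0 -> y = 0.
Hypothesis q_surj : forall c, exists x, q x = c.
Hypothesis q_ker : forall x, q x = 0 <-> exists y, g y = x.

Definition cone_mod i : lmodType A :=
  if i is k.+1 then (res_mod P k.+1 * res_mod Q k)%type else res_mod P 0.

Definition cone_diff_fun i : cone_mod i.+1 -> cone_mod i :=
  match i with
  | 0 => fun u => res_diff P 0 u.1 + f 0 u.2
  | k.+1 => fun u => (res_diff P k.+1 u.1 + f k.+1 u.2, - res_diff Q k u.2)
  end.

Lemma cone_diff_linear i : linear (@cone_diff_fun i).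
Proof.
case: i => [|i] a u v /=; rewrite !linearP /=.
  by rewrite scalerDr addrACA.
by rewrite addrACA -scalerDr.
Qed.

Definition cone_diff i : {linear cone_mod i.+1 -> cone_mod i} :=
  Lin (@cone_diff_linear i).

Lemma cone_aug_linear : linear (fun u : cone_mod 0 => q (res_aug P u)).
Proof. by move=> a u v; rewrite !linearP. Qed.

Definition cone_aug : {linear cone_mod 0 -> C} := Lin cone_aug_linear.

Lemma res_diff_diff (B : nzRingType) (L : lmodType B) (T : resolution L) i x :
  res_diff T i (res_diff T i.+1 x) = 0.
Proof. by apply/res_exact; exists x. Qed.

Lemma res_aug_diff (B : nzRingType) (L : lmodType B) (T : resolution L) x :
  res_aug T (res_diff T 0 x) = 0.
Proof. by apply/res_exact0; exists x. Qed.

Lemma cone_aug_surj c : exists x, cone_aug x = c.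
Proof.
have [m <-] := q_surj c; have [x <-] := res_aug_surj P m.
by exists x.
Qed.

Lemma cone_exact0 x : cone_aug x = 0 <-> exists y, cone_diff 0 y = x.
Proof.
split=> [/q_ker[n]|[[u v] <-]].
  have [z <-] := res_aug_surj Q n; rewrite f_aug => e.
  have /res_exact0[y ey] : res_aug P (x - f 0 z) = 0.
    by rewrite linearB /= e subrr.
  by exists (y, z); rewrite /= /lin_fun /= ey subrK.
apply/q_ker; exists (res_aug Q v).
by rewrite f_aug /lin_fun /= linearD res_aug_diff add0r.
Qed.

Lemma cone_exact i x : cone_diff i x = 0 <-> exists y, cone_diff i.+1 y = x.
Proof.
split.
  case: x => u v h.
  have dv : exists w, res_diff Q i w = v.
    case: i u v h => [|i] u v h; last first.
      have e : - res_diff Q i v = 0 := congr1 snd h.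
      by apply/res_exact; rewrite -[LHS]opprK e oppr0.
    have e : res_diff P 0 u + f 0 v = 0 := h.
    apply/res_exact0/g_inj; rewrite f_aug.
    by have := congr1 (res_aug P) e; rewrite linearD linear0 res_aug_diff add0r.
  case: dv => w ew.
  have du : res_diff P i u + f i v = 0.
    by case: i u v h w ew => [|i] u v h w ew; [|case: h].
  have /res_exact[z ez] : res_diff P i (u + f i.+1 w) = 0.
    by rewrite linearD -f_diff ew.
  exists (z, - w); rewrite /= /lin_fun /= ez !linearN /= ew opprK addrK.
  by [].
move=> [[u v] <-]; case: i x u v => [|i] _ u v; rewrite /= /lin_fun /=.
  by rewrite linearD res_diff_diff add0r linearN f_diff subrr.
rewrite linearD res_diff_diff add0r !linearN f_diff subrr.
by rewrite /= res_diff_diff !oppr0.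
Qed.

Definition cone : resolution C :=
  Resolution cone_aug_surj cone_exact0 cone_exact.

Lemma cone_ind (Phi : lmodType A -> Prop) :
  (forall i, Phi (res_mod P i)) -> (forall i, Phi (res_mod Q i)) ->
  (forall U V : lmodType A, Phi U -> Phi V -> Phi (U * V)%type) ->
  forall i, Phi (res_mod cone i).
Proof. by move=> hP hQ hPQ [|i] /=; [|apply: hPQ]. Qed.

Lemma cone_length k l : res_length_le P k -> res_length_le Q l ->
  res_length_le cone (maxn k l.+1).
Proof.
move=> hP hQ [|i]; rewrite gtn_max ?ltn0 ?andbF // => /andP[ki li] [u v].
by rewrite (hP _ ki u) (hQ _ _ v).
Qed.

End Cone.

(** * Finitely supported sequences *)

Section FiniteSupport.
Variable (A : nzRingType).
Implicit Types (V W : lmodType A).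

Lemma finsupp_prop V :
  submod_prop (fun v : nat -> V => exists n, forall i, (n <= i)%N -> v i = 0).
Proof.
split=> [|a u v [n un] [k vk]]; first by exists 0%N.
exists (maxn n k) => i; rewrite geq_max => /andP[ni ki].
by rewrite -[LHS]/(a *: u i + v i) un // vk // scaler0 addr0.
Qed.

Definition finsupp V := submod_type (Submod (@finsupp_prop V)).
HB.instance Definition _ V := GRing.Lmodule.on (finsupp V).

Definition fs V (v : finsupp V) : nat -> V := val v.

Lemma fs_bound V (v : finsupp V) : exists n, forall i, (n <= i)%N -> fs v i = 0.
Proof. by case: v => v hv; apply/(in_Submod (@finsupp_prop V)). Qed.

Definition mk_finsupp V (v : nat -> V)
    (hv : exists n, forall i, (n <= i)%N -> v i = 0) : finsupp V :=
  exist _ v (proj2 (in_Submod (@finsupp_prop V) v) hv).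

Lemma fs_inj V (u v : finsupp V) : (forall i, fs u i = fs v i) -> u = v.
Proof. by move=> h; apply/val_inj/funext. Qed.

Lemma fsP V a (u v : finsupp V) i : fs (a *: u + v) i = a *: fs u i + fs v i.
Proof. by []. Qed.

(** Termwise choices along v can be cut off where v vanishes, provided 0 is
related to 0. *)
Lemma finsupp_lift V W (T : W -> V -> Prop) (v : finsupp V) :
  T 0 0 -> (forall i, exists w, T w (fs v i)) ->
  exists w : finsupp W, forall i, T (fs w i) (fs v i).
Proof.
move=> T0 /choice[w hw]; have [n vn] := fs_bound v.
pose w' i : W := if (i < n)%N then w i else 0.
have bw : exists n, forall i, (n <= i)%N -> w' i = 0.
  by exists n => i ni; rewrite /w' ltnNge ni.
exists (mk_finsupp bw) => i; rewrite [fs (mk_finsupp bw) i]/(w' i) /w'.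
by case: ltnP => // ni; rewrite vn.
Qed.

Lemma finsupp_map_bound V W (g : {linear V -> W}) (v : finsupp V) :
  exists n, forall i, (n <= i)%N -> g (fs v i) = 0.
Proof.
by have [n vn] := fs_bound v; exists n => i ni; rewrite vn ?linear0.
Qed.

Lemma finsupp_map_linear V W (g : {linear V -> W}) :
  linear (fun v =>
    mk_finsupp (v := fun i => g (fs v i)) (finsupp_map_bound g v)).
Proof. by move=> a u v; apply: fs_inj => i; apply: linearP. Qed.

Definition finsupp_map V W (g : {linear V -> W}) :
  {linear finsupp V -> finsupp W} := Lin (finsupp_map_linear g).

Lemma fs_map V W (g : {linear V -> W}) v i :
  fs (finsupp_map g v) i = g (fs v i).
Proof. by []. Qed.

Lemma single_bound V n (x : V) :
  exists m, forall i, (m <= i)%N -> (if i == n then x else 0) = 0.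
Proof. by exists n.+1 => i; case: eqP => // ->; rewrite ltnn. Qed.

Lemma single_linear V n : linear (fun x : V =>
    mk_finsupp (v := fun i => if i == n then x else 0) (single_bound n x)).
Proof.
move=> a u v; apply: fs_inj => i.
rewrite fsP /fs /=; case: eqP => // _; by rewrite scaler0 addr0.
Qed.

Definition single V n : {linear V -> finsupp V} := Lin (@single_linear V n).

Lemma fs_single V n (x : V) i : fs (single V n x) i = if i == n then x else 0.
Proof. by []. Qed.

Lemma fs_linear V n : linear (fun v : finsupp V => fs v n).
Proof. by []. Qed.

Definition fs_coord V n : {linear finsupp V -> V} := Lin (@fs_linear V n).

Lemma fs_sum V (I : Type) (s : seq I) (F : I -> finsupp V) i :
  fs (\sum_(j <- s) F j) i = \sum_(j <- s) fs (F j) i.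
Proof. exact: (linear_sum (fs_coord V i)). Qed.

Lemma finsupp_singles V (v : finsupp V) n :
  (forall i, (n <= i)%N -> fs v i = 0) ->
  v = \sum_(i < n) single V i (fs v i).
Proof.
move=> vn; apply: fs_inj => i; rewrite fs_sum.
under eq_bigr do rewrite fs_single.
have [ni|ni] := leqP n i.
  rewrite vn // big1 // => j _; case: eqP => // e.
  by move: (ltn_ord j); rewrite -e ltnNge ni.
rewrite (bigD1 (Ordinal ni)) //= eqxx big1 ?addr0 // => j.
by rewrite -val_eqE /= eq_sym => /negbTE ->.
Qed.

Section Resolution.
Variables (M : lmodType A) (P : resolution M).

Lemma finsupp_aug_surj y : exists x, finsupp_map (res_aug P) x = y.
Proof.
have [||x hx] := @finsupp_lift _ _ (fun x y => res_aug P x = y) y.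
- exact: linear0.
- by move=> i; apply: res_aug_surj.
- by exists x; apply: fs_inj.
Qed.

Lemma finsupp_exact0 x : finsupp_map (res_aug P) x = 0 <->
  exists y, finsupp_map (res_diff P 0) y = x.
Proof.
split=> [h|[y <-]]; last first.
  by apply: fs_inj => i; rewrite !fs_map; apply/res_exact0; exists (fs y i).
have [||y hy] := @finsupp_lift _ _ (fun y x => res_diff P 0 y = x) x.
- exact: linear0.
- by move=> i; apply/res_exact0; rewrite -fs_map h.
- by exists y; apply: fs_inj.
Qed.

Lemma finsupp_exact i x : finsupp_map (res_diff P i) x = 0 <->
  exists y, finsupp_map (res_diff P i.+1) y = x.
Proof.
split=> [h|[y <-]]; last first.
  by apply: fs_inj => j; rewrite !fs_map; apply/res_exact; exists (fs y j).
have [||y hy] := @finsupp_lift _ _ (fun y x => res_diff P i.+1 y = x) x.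
- exact: linear0.
- by move=> j; apply/res_exact; rewrite -fs_map h.
- by exists y; apply: fs_inj.
Qed.

Definition finsupp_res : resolution (finsupp M) :=
  Resolution finsupp_aug_surj finsupp_exact0 finsupp_exact.

Lemma finsupp_length k : res_length_le P k -> res_length_le finsupp_res k.
Proof. by move=> hP i ki x; apply: fs_inj => j; apply: hP. Qed.

End Resolution.
End FiniteSupport.

(** * Compatible roots: the submodule they generate and its telescope *)

Section Roots.
(* In the application xi j is the p^j-th root of an element, and eps j is the
   power p - 2 of xi j.+1.  Two factors xi j.+1 are displayed because exactness
   at the first term of the resolutions uses up one of them. *)
Variables (A : comNzRingType) (xi eps : nat -> A).
Hypothesis xiE : forall j, xi j = xi j.+1 * (xi j.+1 * eps j).
Implicit Types (V W M : lmodType A).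

Lemma xi_dvd j k : (j <= k)%N -> exists c, xi j = c * xi k.
Proof.
move=> /subnK <-; elim: (k - j)%N => [|n [c ->]].
  by exists 1; rewrite mul1r.
exists (c * (xi (n + j).+1 * eps (n + j))).
by rewrite [in LHS]xiE -mulrA; congr (c * _); apply: mulrC.
Qed.

(** The multiples of the xi j form an increasing union, so they are closed under
sums without taking linear combinations. *)
Lemma xi_prop V : submod_prop (fun v : V => exists j w, v = xi j *: w).
Proof.
split=> [|a u v [j [w ->]] [k [z ->]]]; first by exists 0%N, 0; rewrite scaler0.
have [c ->] := xi_dvd (leq_maxl j k); have [e ->] := xi_dvd (leq_maxr j k).
exists (maxn j k), ((a * c) *: w + e *: z).
by rewrite scalerDr !scalerA !(mulrC (xi _)) mulrA.
Qed.

Definition xi_part V : submodClosed V := Submod (xi_prop V).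
(** This is I V, for I the ideal generated by the xi j. *)
Definition xi_mod V := submod_type (xi_part V).
HB.instance Definition _ V := GRing.Lmodule.on (xi_mod V).

Definition xi_mul V j (v : V) : xi_mod V :=
  exist _ (xi j *: v)
    (proj2 (in_Submod (xi_prop V) _) (ex_intro _ j (ex_intro _ v erefl))).

Lemma xi_modP V (u : xi_mod V) : exists j v, u = xi_mul j v.
Proof.
case: u => u hu; have [j [v e]] := proj1 (in_Submod (xi_prop V) u) hu.
by exists j, v; apply: val_inj.
Qed.

Lemma xi_incl_linear V : linear (fun u : xi_mod V => val u).
Proof. by []. Qed.
Definition xi_incl V : {linear xi_mod V -> V} := Lin (@xi_incl_linear V).

Lemma xi_map_proof V W (g : {linear V -> W}) (u : xi_mod V) :
  g (val u) \in xi_part W.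
Proof.
have [j [v ->]] := xi_modP u.
by apply/in_Submod; exists j, (g v); rewrite /= linearZ.
Qed.

Lemma xi_map_linear V W (g : {linear V -> W}) :
  linear (fun u => insubmod (xi_map_proof g u) : xi_mod W).
Proof. by move=> a u v; apply: val_inj; apply: linearP. Qed.

Definition xi_map V W (g : {linear V -> W}) : {linear xi_mod V -> xi_mod W} :=
  Lin (xi_map_linear g).

Lemma xi_map_mul V W (g : {linear V -> W}) j v :
  xi_map g (xi_mul j v) = xi_mul j (g v).
Proof. by apply: val_inj; apply: linearZ. Qed.

Definition xi_torsion_free V := forall j (v : V), xi j *: v = 0 -> v = 0.

(** For a quotient A/a by a radical ideal this holds because a power of
xi j.+1 is xi j. *)
Definition xi_reduced V := forall j (v : V), xi j *: v = 0 -> xi j.+1 *: v = 0.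

(** Over a torsion-free resolution P of M, exactness of the submodules xi_mod
P_i in positive degrees is obtained by cancelling xi j.  In degree 0, where M
may have torsion, [xi_reduced] trades xi j for xi j.+1, and the spare factor of
[xiE] keeps the preimage inside the submodule. *)
Section FlatResolution.
Variables (M : lmodType A) (P : resolution M).
Hypothesis M_red : xi_reduced M.
Hypothesis P_tf : forall i, xi_torsion_free (res_mod P i).

Lemma xi_aug_surj y : exists x, xi_map (res_aug P) x = y.
Proof.
have [j [m ->]] := xi_modP y; have [x <-] := res_aug_surj P m.
by exists (xi_mul j x); rewrite xi_map_mul.
Qed.

Lemma xi_exact0 x : xi_map (res_aug P) x = 0 <->
  exists y, xi_map (res_diff P 0) y = x.
Proof.
split=> [|[y <-]]; last first.
  by apply: val_inj; apply/res_exact0; exists (val y).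
have [j [v ->]] := xi_modP x; rewrite xi_map_mul => /(congr1 val) /= /M_red.
rewrite -linearZ => /res_exact0[y hy].
exists (xi_mul j.+1 (eps j *: y)); rewrite xi_map_mul; apply: val_inj => /=.
by rewrite linearZ hy [in RHS]xiE !scalerA -?mulrA (mulrC (eps j)).
Qed.

Lemma xi_exact i x : xi_map (res_diff P i) x = 0 <->
  exists y, xi_map (res_diff P i.+1) y = x.
Proof.
split=> [|[y <-]]; last first.
  by apply: val_inj; apply/res_exact; exists (val y).
have [j [v ->]] := xi_modP x; rewrite xi_map_mul => /(congr1 val) /= /P_tf.
by move=> /res_exact[y <-]; exists (xi_mul j y); rewrite xi_map_mul.
Qed.

Definition xi_res : resolution (xi_mod M) :=
  Resolution xi_aug_surj xi_exact0 xi_exact.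

Lemma xi_length k : res_length_le P k -> res_length_le xi_res k.
Proof. by move=> hP i ki x; apply: val_inj; apply: hP. Qed.

End FlatResolution.

(** For a reduced V, xi_mod V is the direct limit of copies of V along the
multiplications by xi j.+1 * eps j, and [tau] and [sigma] are the two maps of
its standard presentation by the direct sum of these copies. *)
Section Telescope.
Variable V : lmodType A.

Definition tau_fun (w : nat -> V) i : V :=
  w i - (if i is k.+1 then (xi k.+1 * eps k) *: w k else 0).

Lemma tau_bound (w : finsupp V) :
  exists n, forall i, (n <= i)%N -> tau_fun (fs w) i = 0.
Proof.
have [n wn] := fs_bound w; exists n.+1 => -[//|i] ni.
by rewrite /tau_fun !wn ?scaler0 ?subr0 // leqW.
Qed.

Lemma tau_linear :
  linear (fun w => mk_finsupp (v := tau_fun (fs w)) (tau_bound w)).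
Proof.
move=> a u v; apply: fs_inj => i; rewrite fsP.
change (tau_fun (fs (a *: u + v)) i =
        a *: tau_fun (fs u) i + tau_fun (fs v) i).
rewrite /tau_fun fsP; case: i => [|i]; first by rewrite !subr0.
rewrite fsP scalerBr scalerDr !scalerA opprD addrACA.
by rewrite (mulrC a).
Qed.

Definition tau : {linear finsupp V -> finsupp V} := Lin tau_linear.

(** The partial sums of [sigma] telescope on the image of [tau]. *)
Lemma sum_tau w k : \sum_(i < k.+1) xi i *: tau_fun w i = xi k *: w k.
Proof.
elim: k => [|k IH]; first by rewrite big_ord1 /tau_fun subr0.
by rewrite big_ord_recr /= IH /tau_fun scalerBr addrCA scalerA -xiE subrr addr0.
Qed.

Definition sigma_fun (v : finsupp V) : V :=
  \sum_(i < sval (cid (fs_bound v))) xi i *: fs v i.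

Lemma sigma_funE v n : (forall i, (n <= i)%N -> fs v i = 0) ->
  sigma_fun v = \sum_(i < n) xi i *: fs v i.
Proof.
rewrite /sigma_fun; case: cid => k /= vk vn.
wlog kn : k n vk vn / (k <= n)%N.
  by move=> h; have [/h|/ltnW/h] := leqP k n; [apply|move/(_ vn vk)].
rewrite (big_ord_widen_cond n xpredT (fun i => xi i *: fs v i)) //.
rewrite big_mkcond /=.
by apply: eq_bigr => i _; case: ltnP => // ki; rewrite vk ?scaler0.
Qed.

Lemma sigma_linear : linear sigma_fun.
Proof.
move=> a u v; have [n un] := fs_bound u; have [k vk] := fs_bound v.
have un' i : (maxn n k <= i)%N -> fs u i = 0.
  by rewrite geq_max => /andP[/un].
have vk' i : (maxn n k <= i)%N -> fs v i = 0.
  by rewrite geq_max => /andP[_ /vk].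
rewrite (sigma_funE un') (sigma_funE vk') (@sigma_funE _ (maxn n k)).
  rewrite scaler_sumr -big_split; apply: eq_bigr => i _.
  by rewrite fsP scalerDr !scalerA mulrC.
by move=> i ni; rewrite fsP un' ?vk' ?scaler0 ?addr0.
Qed.

Definition sigma : {linear finsupp V -> V} := Lin sigma_linear.

Lemma sigma_single n x : sigma (single V n x) = xi n *: x.
Proof.
rewrite [LHS](@sigma_funE _ n.+1) => [|i]; last first.
  by rewrite fs_single; case: eqP => // ->; rewrite ltnn.
rewrite big_ord_recr /= fs_single eqxx big1 ?add0r // => i _.
by rewrite fs_single ltn_eqF ?scaler0.
Qed.

Lemma sigma_tau w : sigma (tau w) = 0.
Proof.
have [n wn] := fs_bound w; rewrite [LHS](@sigma_funE _ n.+1); last first.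
  by case=> // i ni; rewrite /fs /= /tau_fun !wn ?scaler0 ?subr0 // leqW.
by rewrite [LHS]sum_tau wn ?scaler0.
Qed.

Lemma tau_inj w : tau w = 0 -> w = 0.
Proof.
move=> h; apply: fs_inj => i; have {h} h j : tau_fun (fs w) j = 0.
  by rewrite -[LHS]/(fs (tau w) j) h.
elim: i => [|i IH]; first by have := h 0%N; rewrite /tau_fun subr0.
by have := h i.+1; rewrite /tau_fun IH scaler0 subr0.
Qed.

(** The equation tau w = v is solved by recursion; the point is that the
solution w vanishes eventually.  Past the support of v, xi i *: w i is the full
sum sigma v = 0 by [sum_tau], so xi i.+1 kills w i because V is reduced, and the
recursion gives w i.+1 = 0. *)
Lemma sigma_ker v : xi_reduced V -> sigma v = 0 -> exists w, tau w = v.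
Proof.
move=> Vred sv; have [n vn] := fs_bound v.
pose w := fix w i := fs v i +
  (if i is k.+1 then (xi k.+1 * eps k) *: w k else 0).
have wE i : tau_fun w i = fs v i.
  by rewrite /tau_fun; case: i => [|i] /=; rewrite addrK.
have wn i : (n <= i)%N -> xi i *: w i = 0.
  move=> ni; rewrite -sum_tau -[RHS]sv [RHS](@sigma_funE _ i.+1).
    by apply: eq_bigr => j _; rewrite wE.
  by move=> j ij; rewrite vn // (leq_trans ni) // ltnW.
have bw : exists n, forall i, (n <= i)%N -> w i = 0.
  exists n.+1 => -[//|i] ni.
  have -> : w i.+1 = fs v i.+1 + (xi i.+1 * eps i) *: w i by [].
  by rewrite (vn _ (ltnW ni)) add0r mulrC -scalerA Vred ?wn ?scaler0.
by exists (mk_finsupp (v := w) bw); apply: fs_inj.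
Qed.

Lemma sigma_xi v : sigma v \in xi_part V.
Proof.
rewrite [sigma v]/(sigma_fun v) /sigma_fun rpred_sum // => i _.
by apply/in_Submod; exists i, (fs v i).
Qed.

Lemma sigma_xi_linear : linear (fun v => insubmod (sigma_xi v) : xi_mod V).
Proof. by move=> a u v; apply: val_inj; apply: linearP. Qed.

Definition sigma_onto : {linear finsupp V -> xi_mod V} := Lin sigma_xi_linear.

End Telescope.

Lemma tau_map V W (g : {linear V -> W}) w :
  tau W (finsupp_map g w) = finsupp_map g (tau V w).
Proof.
apply: fs_inj => i; rewrite fs_map.
rewrite -[LHS]/(tau_fun (fun j => g (fs w j)) i) -[fs _ i]/(tau_fun (fs w) i).
by rewrite /tau_fun linearB; case: i => [|i]; rewrite ?linear0 ?linearZ.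
Qed.

Lemma sigma_map V W (g : {linear V -> W}) v :
  sigma W (finsupp_map g v) = g (sigma V v).
Proof.
have [n vn] := fs_bound v.
rewrite [LHS](@sigma_funE _ _ n) => [|i /vn]; last first.
  by rewrite fs_map => ->; rewrite linear0.
rewrite -[sigma V v]/(sigma_fun v) (sigma_funE vn) linear_sum.
by apply: eq_bigr => i _; rewrite fs_map linearZ.
Qed.

End Roots.

(** * Flat modules *)

Section TensorProduct.
Variable A : comNzRingType.
Implicit Types M N P : lmodType A.

Definition map_l (X Y Z : Type) (f : X -> Y) (s : seq (X * Z)) : seq (Y * Z) :=
  [seq (f u.1, u.2) | u <- s].
Definition map_r (X Y Z : Type) (f : Y -> Z) (s : seq (X * Y)) : seq (X * Z) :=
  [seq (u.1, f u.2) | u <- s].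

Lemma map_l_r (X X' Y Y' : Type) (h : X -> X') (f : Y -> Y') s :
  map_l h (map_r f s) = map_r f (map_l h s).
Proof. by rewrite /map_l /map_r -!map_comp. Qed.

(** A derivation of an equality of tensors involves finitely many sums and
multiples; maps h j that respect each of these for large j therefore transport
the derivation for large j, even if no h j is linear. *)
Lemma tensor_eq_eventually M P N (h : nat -> M -> P) (s t : seq (M * N)) :
    (forall j, h j 0 = 0) ->
    (forall x y, exists n, forall j, (n <= j)%N ->
       h j (x + y) = h j x + h j y) ->
    (forall a x, exists n, forall j, (n <= j)%N -> h j (a *: x) = a *: h j x) ->
  tensor_eq s t ->
  exists n, forall j, (n <= j)%N -> tensor_eq (map_l (h j) s) (map_l (h j) t).
Proof.
move=> h0 hD hZ; elim=> {s t}.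
- by move=> s; exists 0%N => j _; apply: tensor_refl.
- by move=> s t _ [n IH]; exists n => j /IH; apply: tensor_sym.
- move=> s t u _ [n IHn] _ [k IHk]; exists (maxn n k) => j.
  by rewrite geq_max => /andP[/IHn h1 /IHk]; apply: tensor_trans.
- move=> s s' t t' _ [n IHn] _ [k IHk]; exists (maxn n k) => j.
  rewrite geq_max /map_l !map_cat => /andP[/IHn h1 /IHk h2].
  exact: tensor_cat.
- by move=> s t; exists 0%N => j _; rewrite /map_l !map_cat; apply: tensor_catC.
- by move=> y; exists 0%N => j _; rewrite /= h0; apply: tensor_0l.
- move=> x x' y; have [n hn] := hD x x'; exists n => j /hn e.
  by rewrite /= e; apply: tensor_Dl.
- by move=> x y y'; exists 0%N => j _; apply: tensor_Dr.
- move=> a x y; have [n hn] := hZ a x; exists n => j /hn e.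
  by rewrite /= e; apply: tensor_Z.
Qed.

Lemma tensor_eq_map M P N (g : {linear M -> P}) (s t : seq (M * N)) :
  tensor_eq s t -> tensor_eq (map_l g s) (map_l g t).
Proof.
move=> st; have [|||n hn] := @tensor_eq_eventually _ _ _ (fun=> g) _ _ _ _ _ st.
- by move=> _; apply: linear0.
- by move=> x y; exists 0%N => _ _; apply: linearD.
- by move=> a x; exists 0%N => _ _; apply: linearZ.
- exact: hn (leqnn n).
Qed.

(** M is flat when it is approximated by a flat module P: the eventually linear
maps h j bring an equality of tensors over M to P, and the linear maps g j,
which eventually undo h j, bring the conclusion back. *)
Lemma flat_approx M P (g : nat -> {linear P -> M}) (h : nat -> M -> P) :
    (forall j, h j 0 = 0) ->
    (forall x y, exists n, forall j, (n <= j)%N ->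
       h j (x + y) = h j x + h j y) ->
    (forall a x, exists n, forall j, (n <= j)%N -> h j (a *: x) = a *: h j x) ->
    (forall x, exists n, forall j, (n <= j)%N -> g j (h j x) = x) ->
  flat_mod P -> flat_mod M.
Proof.
move=> h0 hD hZ gh Pflat N N' f f_inj s t.
move=> /(tensor_eq_eventually h0 hD hZ)[n hn].
have ghs (r : seq (M * N)) : exists k, forall j, (k <= j)%N ->
    map_l (g j) (map_l (h j) r) = r.
  elim: r => [|[x y] r [k IH]]; first by exists 0%N.
  have [l hl] := gh x; exists (maxn k l) => j; rewrite geq_max => /andP[kj lj].
  by rewrite /= hl // [X in _ :: X]IH.
have [k hk] := ghs s; have [l hl] := ghs t.
pose j := maxn n (maxn k l).
have nj : (n <= j)%N by rewrite leq_maxl.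
have kj : (k <= j)%N by rewrite /j leq_max leq_maxl orbT.
have lj : (l <= j)%N by rewrite /j leq_max leq_maxr orbT.
rewrite -(hk j kj) -(hl j lj); apply: tensor_eq_map.
apply: (Pflat _ _ f f_inj).
have := hn j nj; rewrite -[map _ s]/(map_r f s) -[map _ t]/(map_r f t).
by rewrite !map_l_r.
Qed.

Lemma tensor_zero N M (s : seq (M * N)) : (forall x : M, x = 0) ->
  tensor_eq s [::].
Proof.
move=> M0; elim: s => [|[x y] s IH]; first exact: tensor_refl.
rewrite (M0 x) -[_ :: s]/([:: (0, y)] ++ s) -[X in tensor_eq _ X]cats0.
by apply: tensor_cat IH; apply: tensor_0l.
Qed.

Lemma flat_zero M : (forall x : M, x = 0) -> flat_mod M.
Proof.
move=> M0 N N' f _ s t _; apply: (@tensor_trans _ _ _ _ [::]).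
  exact: tensor_zero.
exact/tensor_sym/tensor_zero.
Qed.

Section Product.
Variables M1 M2 : lmodType A.

Lemma prod_fst_linear : linear (fun u : (M1 * M2)%type => u.1).
Proof. by []. Qed.
Lemma prod_snd_linear : linear (fun u : (M1 * M2)%type => u.2).
Proof. by []. Qed.
Lemma prod_inl_linear : linear (fun u : M1 => (u, 0 : M2)).
Proof.
by move=> a u v; apply: injective_projections => //=; rewrite scaler0 addr0.
Qed.
Lemma prod_inr_linear : linear (fun u : M2 => (0 : M1, u)).
Proof.
by move=> a u v; apply: injective_projections => //=; rewrite scaler0 addr0.
Qed.
Definition prod_fst : {linear (M1 * M2)%type -> M1} := Lin prod_fst_linear.
Definition prod_snd : {linear (M1 * M2)%type -> M2} := Lin prod_snd_linear.
Definition prod_inl : {linear M1 -> (M1 * M2)%type} := Lin prod_inl_linear.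
Definition prod_inr : {linear M2 -> (M1 * M2)%type} := Lin prod_inr_linear.

(** The tensor product commutes with binary direct sums. *)
Lemma tensor_prod N (s : seq ((M1 * M2) * N)) :
  tensor_eq s
    (map_l prod_inl (map_l prod_fst s) ++ map_l prod_inr (map_l prod_snd s)).
Proof.
elim: s => [|[[x1 x2] y] s IH]; first exact: tensor_refl.
pose a := [:: ((x1, 0) : M1 * M2, y)]; pose b := [:: ((0, x2) : M1 * M2, y)].
pose s1 := map_l prod_inl (map_l prod_fst s).
pose s2 := map_l prod_inr (map_l prod_snd s).
apply: (@tensor_trans _ _ _ _ ((a ++ b) ++ (s1 ++ s2))).
  apply: (tensor_cat _ IH : tensor_eq ([:: ((x1, x2), y)] ++ s) _).
  have e : (x1, x2) = (x1, 0) + (0, x2) :> (M1 * M2)%type.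
    by apply: injective_projections; rewrite /= ?addr0 ?add0r.
  by rewrite e; apply: tensor_Dl.
rewrite -[X in tensor_eq _ X]/((a ++ s1) ++ (b ++ s2)) -!catA.
apply: tensor_cat; first exact: tensor_refl.
rewrite !catA; apply: tensor_cat; last exact: tensor_refl.
exact: tensor_catC.
Qed.

Lemma flat_prod : flat_mod M1 -> flat_mod M2 -> flat_mod (M1 * M2)%type.
Proof.
move=> flat1 flat2 N N' f f_inj s t st.
apply: tensor_trans (tensor_prod s) _.
apply/tensor_sym; apply: tensor_trans (tensor_prod t) _; apply/tensor_sym.
apply: tensor_cat; apply: tensor_eq_map.
  apply: (flat1 _ _ f f_inj); have := tensor_eq_map prod_fst st.
  by rewrite -[map _ s]/(map_r f s) -[map _ t]/(map_r f t) !map_l_r.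
apply: (flat2 _ _ f f_inj); have := tensor_eq_map prod_snd st.
by rewrite -[map _ s]/(map_r f s) -[map _ t]/(map_r f t) !map_l_r.
Qed.
End Product.

Section Ring.
Variable N : lmodType A.
Definition tensor_eval (M : lmodType A) (s : seq (A^o * M)) : M :=
  \sum_(u <- s) (u.1 : A) *: u.2.

(** [tensor_evalP] and [tensor_eval1] identify the tensor product of A and N
with N. *)
Lemma tensor_evalP (s t : seq (A^o * N)) :
  tensor_eq s t -> tensor_eval s = tensor_eval t.
Proof.
elim=> {s t} //.
- by move=> s t u _ -> _ ->.
- by move=> s s' t t' _ + _; rewrite /tensor_eval !big_cat /= => -> ->.
- by move=> s t; rewrite /tensor_eval !big_cat /= addrC.
- by move=> y; rewrite /tensor_eval big_seq1 big_nil scale0r.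
- by move=> x x' y; rewrite /tensor_eval !big_cons !big_nil !addr0 scalerDl.
- by move=> x y y'; rewrite /tensor_eval !big_cons !big_nil !addr0 scalerDr.
- by move=> a x y; rewrite /tensor_eval !big_seq1 scalerA mulrC.
Qed.

Lemma tensor_scalar (a : A) (y : N) :
  tensor_eq [:: (a : A^o, y)] [:: (1 : A^o, a *: y)].
Proof.
by have := tensor_Z a (1 : A^o) y; rewrite [a *: (1 : A^o)](mulr1 a).
Qed.

Lemma tensor_eval1 (s : seq (A^o * N)) :
  tensor_eq s [:: (1 : A^o, tensor_eval s)].
Proof.
elim: s => [|[a y] s IH]; rewrite /tensor_eval ?big_nil ?big_cons /=.
  apply/tensor_sym; rewrite -(scale0r (0 : N)).
  apply: tensor_trans (tensor_0l A^o (0 : N)); exact/tensor_sym/tensor_scalar.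
apply: (@tensor_trans _ _ _ _
  ([:: (1 : A^o, a *: y)] ++ [:: (1 : A^o, tensor_eval s)])).
  apply: (tensor_cat _ IH : tensor_eq ([:: (a : A^o, y)] ++ s) _).
  exact: tensor_scalar.
exact/tensor_sym/tensor_Dr.
Qed.
End Ring.

Lemma flat_ring : flat_mod (A^o : lmodType A).
Proof.
move=> N N' f f_inj s t /tensor_evalP e.
apply: tensor_trans (tensor_eval1 s) _.
suff -> : tensor_eval s = tensor_eval t by apply/tensor_sym/tensor_eval1.
have fE r : tensor_eval [seq (u.1, f u.2) | u <- r] = f (tensor_eval r).
  rewrite /tensor_eval big_map linear_sum; apply: eq_bigr => u _.
  by rewrite linearZ.
by apply: f_inj; rewrite -!fE.
Qed.

End TensorProduct.

(** * Countable generators and countable bases *)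

Section Generators.
Variable A : nzRingType.
Implicit Types M : lmodType A.

Definition in_span M (I : Type) (b : I -> M) (x : M) : Prop :=
  exists s : seq (A * I), x = \sum_(u <- s) u.1 *: b u.2.

Lemma in_span0 M (I : Type) (b : I -> M) : in_span b 0.
Proof. by exists [::]; rewrite big_nil. Qed.

Lemma in_spanD M (I : Type) (b : I -> M) x y :
  in_span b x -> in_span b y -> in_span b (x + y).
Proof. by move=> [s ->] [t ->]; exists (s ++ t); rewrite big_cat. Qed.

Lemma in_span_sum M (I : Type) (b : I -> M) (J : Type) (r : seq J)
    (F : J -> M) :
  (forall j, in_span b (F j)) -> in_span b (\sum_(j <- r) F j).
Proof.
move=> h; elim: r => [|j r IH]; first by rewrite big_nil; apply: in_span0.
by rewrite big_cons; apply: in_spanD.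
Qed.

Lemma in_span_map M M' (I I' : Type) (b : I -> M) (b' : I' -> M')
    (g : {linear M -> M'}) (k : I -> I') x :
  (forall i, g (b i) = b' (k i)) -> in_span b x -> in_span b' (g x).
Proof.
move=> gb [s ->]; exists [seq (u.1, k u.2) | u <- s].
rewrite linear_sum big_map; apply: eq_bigr => u _; by rewrite linearZ gb.
Qed.

Definition count_gen M : Prop :=
  exists (I : countType) (b : I -> M), forall x, in_span b x.

Lemma count_genP M : count_gen M -> countably_generated M.
Proof.
move=> [I [b hb]]; exists (fun n => oapp b 0 (unpickle n)) => x.
have [s ->] := hb x; elim: s {x} => [|[a i] s [n [c e]]].
  by exists 0%N, (fun=> 0); rewrite big_nil big_ord0.
exists (maxn n (pickle i).+1), (fun j => (if j == pickle i then a else 0) +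
  (if (j < n)%N then c j else 0)).
under [RHS]eq_bigr do rewrite scalerDl.
rewrite [LHS]big_cons e big_split /=; congr (_ + _).
  rewrite (bigD1 (Ordinal (leq_maxr n (pickle i).+1))) //= eqxx pickleK /=.
  rewrite big1 ?addr0 // => j; rewrite -val_eqE /= => /negbTE ->.
  exact: scale0r.
rewrite (big_ord_widen_cond _ xpredT (fun j => c j *: oapp b 0 (unpickle j))
  (leq_maxl n (pickle i).+1)) big_mkcond /=.
by apply: eq_bigr => j _; case: ifP => //; rewrite scale0r.
Qed.

(** A countable basis b together with its coordinate forms e.  Carrying the
coordinates makes stability under products and finitely supported sequences
immediate, and gives linear independence for free. *)
Definition based M : Prop :=
  exists (I : countType) (b : I -> M) (e : I -> {linear M -> A^o}),
    (forall i j, e i (b j) = (i == j)%:R) /\ forall x, in_span b x.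

Lemma based_count_gen M : based M -> count_gen M.
Proof. by move=> [I [b [e [_ hb]]]]; exists I, b. Qed.

Lemma based_free M : based M -> free_mod M.
Proof.
move=> [I [b [e [eb hb]]]].
have e_sum s (c : I -> A) j : uniq s -> j \in s ->
    e j (\sum_(i <- s) c i *: b i) = c j.
  move=> us js; rewrite linear_sum (bigD1_seq j) //= linearZ /= eb eqxx.
  rewrite big1 ?addr0 => [|i ij]; first by rewrite [LHS]mulr1.
  by rewrite linearZ /= eb eq_sym (negbTE ij) scaler0.
exists I, b; split=> [x|s c us h j js]; last first.
  by rewrite -(e_sum s c j us js) h linear0.
have [t ->] := hb x; pose s := undup [seq u.2 | u <- t].
exists s, (fun i => \sum_(u <- t | u.2 == i) u.1).
under [RHS]eq_bigr do rewrite scaler_suml big_mkcond /=.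
rewrite [RHS]exchange_big /= !big_seq; apply: eq_bigr => u ut.
rewrite (bigD1_seq u.2) ?undup_uniq //=; last first.
  by rewrite mem_undup; apply/mapP; exists u.
by rewrite eqxx big1 ?addr0 // => i; rewrite eq_sym => /negbTE ->.
Qed.

Lemma based_zero M : (forall x : M, x = 0) -> based M.
Proof.
move=> M0; exists void, (fun v : void => match v with end),
  (fun v : void => match v with end); split=> [[]|x].
by rewrite (M0 x); apply: in_span0.
Qed.

Lemma count_gen_zero M : (forall x : M, x = 0) -> count_gen M.
Proof. by move=> M0; apply/based_count_gen/based_zero. Qed.

Lemma based_ring : based (A^o : lmodType A).
Proof.
have idl : linear (fun x : A^o => x) by [].
exists unit, (fun=> 1 : A^o), (fun=> Lin idl); split=> [[] [] //|x].
by exists [:: (x : A, tt)]; rewrite big_seq1 [RHS]mulr1.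
Qed.
End Generators.

Section GeneratorsProduct.
Variable A : comNzRingType.
Implicit Types M : lmodType A.

Definition sum_gens M1 M2 (I1 I2 : Type) (b1 : I1 -> M1) (b2 : I2 -> M2)
    (i : I1 + I2) : (M1 * M2)%type :=
  match i with inl i => (b1 i, 0) | inr i => (0, b2 i) end.

Lemma in_span_prod M1 M2 (I1 I2 : Type) (b1 : I1 -> M1) (b2 : I2 -> M2) x :
  (forall x, in_span b1 x) -> (forall x, in_span b2 x) ->
  in_span (sum_gens b1 b2) x.
Proof.
move=> h1 h2; have -> : x = prod_inl M1 M2 x.1 + prod_inr M1 M2 x.2.
  by apply: injective_projections; rewrite /= /lin_fun /= ?addr0 ?add0r.
apply: in_spanD; first exact: (in_span_map (k := inl)) (h1 _).
exact: (in_span_map (k := inr)) (h2 _).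
Qed.

Lemma count_gen_prod M1 M2 : count_gen M1 -> count_gen M2 ->
  count_gen (M1 * M2)%type.
Proof.
move=> [I1 [b1 h1]] [I2 [b2 h2]]; exists (I1 + I2)%type, (sum_gens b1 b2) => x.
exact: in_span_prod.
Qed.

Lemma comp_linear (U V W : lmodType A)
    (f : {linear V -> W}) (g : {linear U -> V}) :
  linear (fun x => f (g x)).
Proof. by move=> a u v; rewrite !linearP. Qed.

Lemma based_prod M1 M2 : based M1 -> based M2 -> based (M1 * M2)%type.
Proof.
move=> [I1 [b1 [e1 [eb1 h1]]]] [I2 [b2 [e2 [eb2 h2]]]].
exists (I1 + I2)%type, (sum_gens b1 b2), (fun i => match i with
  | inl i => Lin (comp_linear (e1 i) (prod_fst M1 M2))
  | inr i => Lin (comp_linear (e2 i) (prod_snd M1 M2)) end).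
split=> [[i|i] [j|j]|x]; rewrite /= /lin_fun /= /lin_fun ?eb1 ?eb2 ?linear0 //.
exact: in_span_prod.
Qed.

Lemma based_finsupp M : based M -> based (finsupp M).
Proof.
move=> [I [b [e [eb h]]]].
exists (I * nat)%type, (fun i => single M i.2 (b i.1)),
  (fun i => Lin (comp_linear (e i.1) (fs_coord M i.2))).
split=> [[i n] [j k]|x].
  rewrite -[LHS]/(e i (fs (single M k (b j)) n)) fs_single.
  rewrite -pair_eqE /pair_eq /=.
  by case: eqP => _; rewrite ?andbT ?andbF ?eb ?linear0.
have [n xn] := fs_bound x; rewrite (finsupp_singles xn).
apply: in_span_sum => i.
by apply: (in_span_map (k := fun j => (j, i : nat))) (h _).
Qed.

End GeneratorsProduct.

(** * Flatness and generators of the submodule generated by the roots *)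

Section FlatXi.
Variables (A : comNzRingType) (xi eps : nat -> A).
Hypothesis xiE : forall j, xi j = xi j.+1 * (xi j.+1 * eps j).
Implicit Types V : lmodType A.

Lemma xi_mul_linear V j : linear (xi_mul xiE j : V -> _).
Proof.
by move=> a u v; apply: val_inj; rewrite /= scalerDr !scalerA mulrC.
Qed.

Lemma xi_modP_large V (u : xi_mod xiE V) :
  exists n, forall j, (n <= j)%N -> exists v, u = xi_mul xiE j v.
Proof.
have [n [v ->]] := xi_modP u; exists n => j /(xi_dvd xiE)[c e].
by exists (c *: v); apply: val_inj; rewrite /= e scalerA mulrC.
Qed.

Lemma count_gen_xi V : count_gen V -> count_gen (xi_mod xiE V).
Proof.
move=> [I [b h]]; exists (I * nat)%type, (fun i => xi_mul xiE i.2 (b i.1)) => x.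
have [j [v ->]] := xi_modP x.
exact: (in_span_map (g := Lin (@xi_mul_linear V j)) (k := fun i => (i, j)))
  (h v).
Qed.

(** As V has no xi-torsion, division by xi j is well defined and linear on the
multiples of xi j, and these exhaust [xi_mod] as j grows. *)
Lemma flat_xi V : xi_torsion_free xi V -> flat_mod V -> flat_mod (xi_mod xiE V).
Proof.
(* [h j] is division by xi j, extended by 0 to the elements that are not
   multiples of xi j. *)
move=> Vtf; pose h j (u : xi_mod xiE V) : V :=
  if pselect (exists v, u = xi_mul xiE j v) is left e then sval (cid e) else 0.
have hK j v : h j (xi_mul xiE j v) = v.
  rewrite /h; case: pselect => [e|[]]; last by exists v.
  case: cid => w /= /(congr1 val) /= /eqP; rewrite -subr_eq0 -scalerBr.
  by move=> /eqP/Vtf/eqP; rewrite subr_eq0 => /eqP.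
have mulD j (v w : V) : xi_mul xiE j v + xi_mul xiE j w = xi_mul xiE j (v + w).
  by apply: val_inj; rewrite /= scalerDr.
have mulZ j a (v : V) : a *: xi_mul xiE j v = xi_mul xiE j (a *: v).
  by apply: val_inj; rewrite /= !scalerA mulrC.
apply: (@flat_approx _ _ _ (fun j => Lin (@xi_mul_linear V j)) h).
- move=> j; rewrite -[X in h j X](linear0 (Lin (@xi_mul_linear V j))).
  exact: hK.
- move=> x y; have [n xn] := xi_modP_large x; have [k yk] := xi_modP_large y.
  exists (maxn n k) => j; rewrite geq_max => /andP[/xn[v ->] /yk[w ->]].
  by rewrite mulD !hK.
- move=> a x; have [n xn] := xi_modP_large x; exists n => j /xn[v ->].
  by rewrite mulZ !hK.
- move=> x; have [n xn] := xi_modP_large x; exists n => j /xn[v ->].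
  by rewrite hK.
Qed.

End FlatXi.

(** * Resolving the quotient by one more generator *)

Section Quotients.
Variable A : comNzRingType.
Implicit Types a : ideal A.

Lemma quot_proj0 a (x : A^o) : quot_proj a x = 0 <-> x \in a.
Proof. by rewrite -{2}[x]subr0 -quot_proj_eq linear0. Qed.

Lemma quot_lift a a' : {subset a <= a'} ->
  exists q : {linear quot_mod a -> quot_mod a'},
    forall x, q (quot_proj a x) = quot_proj a' x.
Proof.
move=> sub; have /choice[r hr] (u : quot_mod a) : exists x, u = quot_proj a x.
  exact: quot_proj_surj.
have qE x : quot_proj a' (r (quot_proj a x)) = quot_proj a' x.
  by apply/quot_proj_eq/sub/quot_proj_eq; rewrite -hr.
have q_linear : linear (fun u => quot_proj a' (r u)).
  by move=> c u v; rewrite (hr u) (hr v) -linearP !qE linearP.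
by exists (Lin q_linear).
Qed.

Lemma zero_linear (U V : lmodType A) : linear (fun _ : U => 0 : V).
Proof. by move=> c u v; rewrite scaler0 addr0. Qed.

Lemma quot_zero a (u : quot_mod a) : (1 : A) \in a -> u = 0.
Proof.
move=> a1; have [x ->] := quot_proj_surj u; apply/quot_proj0.
by rewrite -[x]mulr1; apply: ideal_mulr.
Qed.

Lemma unit_ideal_res a : (1 : A) \in a -> exists P : resolution (quot_mod a),
  forall i (x : res_mod P i), x = 0.
Proof.
move=> a1; have id_linear : linear (fun u : quot_mod a => u) by [].
pose T (i : nat) : lmodType A := quot_mod a.
pose d i : {linear T i.+1 -> T i} := Lin (@zero_linear (T i.+1) (T i)).
have surj y : exists x, Lin id_linear x = y by exists y.
have ex0 (x : T 0%N) : Lin id_linear x = 0 <-> exists y, d 0%N y = x.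
  by split=> _; [exists 0|]; rewrite ?[x]quot_zero // quot_zero.
have ex i (x : T i.+1) : d i x = 0 <-> exists y, d i.+1 y = x.
  by split=> // _; exists 0; rewrite [x]quot_zero.
by exists (Resolution surj ex0 ex) => i x; apply: quot_zero.
Qed.

(** The terms of the resolution of A/0 by A alone. *)
Definition zero_res_mod i : lmodType A := if i is 0 then A^o else 'rV[A]_0.

Lemma zero_res_modP (Phi : lmodType A -> Prop) :
    Phi A^o -> (forall M : lmodType A, (forall x : M, x = 0) -> Phi M) ->
  forall i, Phi (zero_res_mod i).
Proof. by move=> h h0 [|i] //=; apply: h0 => x; apply: thinmx0. Qed.

Lemma zero_ideal_res a : (forall x, x \in a <-> x = 0) ->
  exists P : resolution (quot_mod a),
    (forall i, res_mod P i = zero_res_mod i) /\ res_length_le P 0.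
Proof.
move=> a0; pose T := zero_res_mod.
pose d i : {linear T i.+1 -> T i} := Lin (@zero_linear (T i.+1) (T i)).
have ex0 (x : T 0%N) : quot_proj a x = 0 <-> exists y, d 0%N y = x.
  by rewrite quot_proj0 a0; split=> [->|[y <-]] //; exists 0.
have ex i (x : T i.+1) : d i x = 0 <-> exists y, d i.+1 y = x.
  by split=> // _; exists 0; rewrite [x]thinmx0.
have surj y : exists x : T 0%N, quot_proj a x = y.
  by have [x ->] := quot_proj_surj y; exists x.
exists (Resolution surj ex0 ex); split=> // -[//|i] _ x.
exact: thinmx0.
Qed.

End Quotients.

Section AddRoots.
Variables (A : comNzRingType) (p : nat) (xi : nat -> A).
Hypothesis p_gt1 : (1 < p)%N.
Hypothesis xi_root : forall j, xi j.+1 ^+ p = xi j.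
Variables (a a' : ideal A).
Hypothesis a_rad : radical_ideal a.
Hypothesis a'P : forall y : A, y \in a' <-> exists j b, y - xi j * b \in a.

Let eps j := xi j.+1 ^+ (p - 2).

Lemma xi_eps j : xi j = xi j.+1 * (xi j.+1 * eps j).
Proof.
rewrite -xi_root -!exprS; congr (_ ^+ _).
by rewrite -[LHS](subnK p_gt1) addn2.
Qed.

Let M : lmodType A := quot_mod a.

Lemma quot_xi_reduced : xi_reduced xi M.
Proof.
move=> j u; have [x ->] := quot_proj_surj u.
rewrite -!linearZ => /quot_proj0 h; apply/quot_proj0.
apply: (a_rad (n := p)); rewrite -[_ *: x]/(xi j.+1 * x) exprMn xi_root.
case: p p_gt1 => // k _; rewrite exprSr mulrCA.
exact: ideal_mulr.
Qed.

(** With I the ideal generated by the xi j, a' is a + I, and the kernel of the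
projection A/a -> A/(a + I) is I (A/a). *)
Lemma quot_add_roots : exists q : {linear M -> quot_mod a'},
  (forall c, exists x, q x = c) /\
  forall x, q x = 0 <-> exists y, xi_incl xi_eps M y = x.
Proof.
have [|q hq] := @quot_lift _ a a'.
  by move=> y ya; apply/a'P; exists 0%N, 0; rewrite mulr0 subr0.
exists q; split=> [c|u].
  by have [x ->] := quot_proj_surj c; exists (quot_proj a x).
have [x ->] := quot_proj_surj u; rewrite hq quot_proj0 a'P.
split=> [[j [b h]]|[y]].
  exists (xi_mul xi_eps j (quot_proj a b : M)).
  apply/esym; rewrite -[RHS]/(xi j *: quot_proj a b) -linearZ.
  exact/quot_proj_eq.
have [j [v ->]] := xi_modP y; have [b ->] := quot_proj_surj v.
rewrite -[LHS]/(xi j *: quot_proj a b) -linearZ => /esym/quot_proj_eq h.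
by exists j, b.
Qed.

(** The cone of the inclusion of the subresolution [xi_res] in P. *)
Lemma flat_step (Phi : lmodType A -> Prop) (P : resolution M) k :
    (forall V, Phi V -> xi_torsion_free xi V) ->
    (forall V, Phi V -> Phi (xi_mod xi_eps V)) ->
    (forall U V : lmodType A, Phi U -> Phi V -> Phi (U * V)%type) ->
    (forall i, Phi (res_mod P i)) -> res_length_le P k ->
  exists T : resolution (quot_mod a'),
    (forall i, Phi (res_mod T i)) /\ res_length_le T k.+1.
Proof.
move=> Ptf Pxi Pprod hP lP; have [q [q_surj q_ker]] := quot_add_roots.
have Ptf' i : xi_torsion_free xi (res_mod P i) by apply: Ptf.
pose Q := xi_res xi_eps quot_xi_reduced Ptf'.
have g_inj y : xi_incl xi_eps M y = 0 -> y = 0 by move=> h; apply: val_inj.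
pose f i : {linear res_mod Q i -> res_mod P i} := xi_incl xi_eps (res_mod P i).
have fd i y : f i (res_diff Q i y) = res_diff P i (f i.+1 y) by [].
have fa y : xi_incl xi_eps M (res_aug Q y) = res_aug P (f 0%N y) by [].
exists (cone fd fa g_inj q_surj q_ker); split.
  by apply: cone_ind => // i; apply: Pxi.
have lQ : res_length_le Q k.
  exact: (@xi_length _ _ _ xi_eps _ _ quot_xi_reduced Ptf' k lP).
by rewrite -(maxn_idPr (leqnSn k)); apply: cone_length.
Qed.

(** Two cones: the cone of tau on P^(N) resolves xi_mod M, and sigma maps it
to P over the inclusion of xi_mod M in M. *)
Lemma free_step (Phi : lmodType A -> Prop) (P : resolution M) k :
    (forall V, Phi V -> Phi (finsupp V)) ->
    (forall U V : lmodType A, Phi U -> Phi V -> Phi (U * V)%type) ->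
    (forall i, Phi (res_mod P i)) -> res_length_le P k ->
  exists T : resolution (quot_mod a'),
    (forall i, Phi (res_mod T i)) /\ res_length_le T k.+2.
Proof.
move=> Pfs Pprod hP lP; have [q [q_surj q_ker]] := quot_add_roots.
pose Q := finsupp_res P.
pose t i : {linear res_mod Q i -> res_mod Q i} := tau xi eps (res_mod P i).
have Qtau i y : t i (res_diff Q i y) = res_diff Q i (t i.+1 y).
  exact: tau_map.
have Qtau0 y : tau xi eps M (res_aug Q y) = res_aug Q (t 0%N y).
  exact: tau_map.
have s_surj c : exists x, sigma_onto xi_eps M x = c.
  have [j [v ->]] := xi_modP c; exists (single M j v).
  by apply: val_inj; apply: (sigma_single xi).
have s_ker x : sigma_onto xi_eps M x = 0 <-> exists y, tau xi eps M y = x.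
  split=> [/(congr1 val) /= h|[y <-]]; last first.
    by apply: val_inj; apply: (sigma_tau xi_eps).
  exact: (sigma_ker xi_eps quot_xi_reduced h).
pose S := cone Qtau Qtau0 (@tau_inj _ xi eps M) s_surj s_ker.
pose f i : {linear res_mod S i -> res_mod P i} :=
  match i with
  | 0 => sigma xi (res_mod P 0)
  | k.+1 => Lin (comp_linear (sigma xi (res_mod P k.+1)) (prod_fst _ _))
  end.
have fd i y : f i (res_diff S i y) = res_diff P i (f i.+1 y).
  have sd (z : finsupp (res_mod P i.+1) * finsupp (res_mod P i)) :
      sigma xi _ (finsupp_map (res_diff P i) z.1 + tau xi eps _ z.2) =
      res_diff P i (sigma xi _ z.1).
    by rewrite linearD (sigma_tau xi_eps) addr0 sigma_map.
  by case: i y sd => [|i] y sd; apply: sd.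
have fa y : xi_incl xi_eps M (res_aug S y) = res_aug P (f 0%N y).
  exact: sigma_map.
have g_inj y : xi_incl xi_eps M y = 0 -> y = 0 by move=> h; apply: val_inj.
exists (cone fd fa g_inj q_surj q_ker); split.
  apply: cone_ind => //; apply: cone_ind => // i; exact: Pfs.
have lQ : res_length_le Q k := finsupp_length lP.
have lS : res_length_le S k.+1.
  by rewrite -(maxn_idPr (leqnSn k)); apply: cone_length.
by rewrite -(maxn_idPr (leqW (leqnSn k))); apply: cone_length.
Qed.

End AddRoots.

(** * Radical ideals of a perfect domain *)

Section PerfectDomain.
Variables (A : comNzRingType) (p : nat) (charA : p \in [pchar A]).
Hypothesis A_dom : forall x y : A, x * y = 0 -> x = 0 \/ y = 0.
Variable r : A -> A.
Hypothesis rE : forall x, r x ^+ p = x.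

Let p_gt1 : (1 < p)%N := prime_gt1 (pcharf_prime charA).

Definition root x j : A := iter j r x.

Lemma rootE x j : root x j.+1 ^+ p = root x j.
Proof. exact: rE. Qed.

Lemma root_pow x j : root x j ^+ (p ^ j) = x.
Proof. by elim: j => [|j IH]; rewrite ?expr1 // expnS exprM rootE. Qed.

Lemma root_eq0 x j : root x j = 0 -> x = 0.
Proof.
move=> h; rewrite -(root_pow x j) h expr0n.
by rewrite expn_eq0 -leqn0 leqNgt (ltnW p_gt1).
Qed.

Lemma exprB_pchar (x y : A) : (x - y) ^+ p = x ^+ p - y ^+ p.
Proof. by rewrite -!(pFrobenius_autE charA) rmorphB. Qed.

Lemma expr_eq0_dom (x : A) n : x ^+ n = 0 -> x = 0.
Proof.
elim: n => [|n IH]; first by move/eqP; rewrite expr0 oner_eq0.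
by rewrite exprS => /A_dom[|/IH].
Qed.

(** Every exponent n is below p^n. *)
Lemma radicalP (a : ideal A) :
  (forall x : A, x ^+ p \in a -> x \in a) -> radical_ideal a.
Proof.
move=> h x n xn.
have : x ^+ (p ^ n) \in a.
  have /subnK <- : (n <= p ^ n)%N by apply/ltnW/ltn_expl.
  by rewrite exprD; apply: ideal_mulr.
by elim: n {xn} => [|n IH]; rewrite ?expr1 // expnSr exprM => /h.
Qed.

(** Membership in the sum of the ideals I_x, x in xs. *)
Fixpoint root_sum (xs : seq A) (y : A) : Prop :=
  if xs is x :: xs' then exists j b, root_sum xs' (y - root x j * b)
  else y = 0.

Lemma root_sum_prop xs : submod_prop (root_sum xs : A^o -> Prop).
Proof.
elim: xs => [|x xs [IH0 IHD]]; split=> //=.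
- by move=> c u v -> ->; rewrite scaler0 addr0.
- by exists 0%N, 0; rewrite mulr0 subr0.
- move=> c u v [j [b hb]] [k [e he]].
  have [f ef] := xi_dvd (xi_eps p_gt1 (rootE x)) (leq_maxl j k).
  have [g eg] := xi_dvd (xi_eps p_gt1 (rootE x)) (leq_maxr j k).
  exists (maxn j k), (c * (f * b) + g * e).
  have := IHD c _ _ hb he; congr root_sum.
  rewrite ef eg -[LHS]/(c * (u - _) + (v - _)) -[c *: u + v]/(c * u + v).
  rewrite mulrBr addrACA -opprD mulrDr; congr (_ - (_ + _)).
    by rewrite [RHS]mulrCA [X in _ = c * X]mulrCA !mulrA.
  by rewrite mulrCA mulrA.
Qed.

Definition root_ideal xs : ideal A := Submod (root_sum_prop xs).

Lemma in_root_ideal xs y : y \in root_ideal xs <-> root_sum xs y.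
Proof. exact: (in_Submod (root_sum_prop xs) y). Qed.

(** Frobenius is additive and bijective, and it permutes the roots of x up to a
shift of index, so p-th roots can be extracted term by term. *)
Lemma root_ideal_radical xs : radical_ideal (root_ideal xs).
Proof.
apply: radicalP => y /in_root_ideal h; apply/in_root_ideal; move: y h.
elim: xs => [|x xs IH] y /=; first exact: expr_eq0_dom.
move=> [j [b h]]; exists j.+1, (r b); apply: IH.
by rewrite exprB_pchar exprMn rootE rE.
Qed.

Lemma mem_root_ideal xs x : x \in xs -> root_sum xs x.
Proof.
elim: xs => // z xs IH; rewrite inE => /orP[/eqP <-|/IH h] /=.
  by exists 0%N, 1; rewrite mulr1 subrr; apply: (root_sum_prop xs).1.
by exists 0%N, 0; rewrite mulr0 subr0.
Qed.

Lemma root_sum_min xs (a : ideal A) y : radical_ideal a -> {subset xs <= a} ->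
  root_sum xs y -> y \in a.
Proof.
move=> arad; elim: xs y => [|x xs IH] y xsa /=; first by move->; apply: ideal_0.
move=> [j [b h]]; rewrite -(subrK (root x j * b) y); apply: ideal_add.
  by apply: IH h => z zxs; apply: xsa; rewrite inE zxs orbT.
rewrite mulrC; apply: ideal_mulr; apply: (arad _ (p ^ j)%N).
by rewrite root_pow; apply: xsa; rewrite mem_head.
Qed.

(** The invariant of the terms in the induction of [flat_resolution]; [xi_res]
is built by cancelling roots, whence the torsion-freeness. *)
Definition flat_cg_tf (V : lmodType A) : Prop :=
  [/\ flat_mod V, count_gen V &
      forall (c : A) (v : V), c *: v = 0 -> c = 0 \/ v = 0].

Lemma flat_cg_tf_ring : flat_cg_tf A^o.
Proof.
split; [exact: flat_ring | exact/based_count_gen/based_ring|].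
by move=> c v; apply: A_dom.
Qed.

Lemma flat_cg_tf_zero (V : lmodType A) : (forall x : V, x = 0) -> flat_cg_tf V.
Proof.
by move=> V0; split; [exact: flat_zero | exact: count_gen_zero | right].
Qed.

Lemma flat_cg_tf_prod (U V : lmodType A) :
  flat_cg_tf U -> flat_cg_tf V -> flat_cg_tf (U * V)%type.
Proof.
move=> [fU cU dU] [fV cV dV]; split.
- exact: flat_prod.
- exact: count_gen_prod.
- move=> c [u v] h; have [->|cn0] := pselect (c = 0); first by left.
  right; have [//|u0] := dU c u (congr1 fst h).
  by have [//|v0] := dV c v (congr1 snd h); rewrite u0 v0.
Qed.

Lemma flat_cg_tf_xi (xi eps : nat -> A)
    (xiE : forall j, xi j = xi j.+1 * (xi j.+1 * eps j)) (V : lmodType A) :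
  xi_torsion_free xi V -> flat_cg_tf V -> flat_cg_tf (xi_mod xiE V).
Proof.
move=> Vtf [fV cV dV]; split; [exact: flat_xi | exact: count_gen_xi|].
move=> c v h; have [|v0] := dV c (val v) (congr1 val h); first by left.
by right; apply: val_inj.
Qed.

(** The generator 0 contributes nothing and is skipped: cancelling the roots of
x requires x to be nonzero. *)
Theorem flat_resolution xs (a : ideal A) :
    (forall y : A, y \in a <-> root_sum xs y) ->
  exists P : resolution (quot_mod a),
    (forall i, flat_cg_tf (res_mod P i)) /\ res_length_le P (size xs).
Proof.
elim: xs a => [|x xs IH] a ha.
  have [P [hP lP]] := zero_ideal_res ha; exists P; split=> // i.
  rewrite hP; apply: zero_res_modP.
    exact: flat_cg_tf_ring.
  exact: flat_cg_tf_zero.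
have [x0|x0] := pselect (x = 0).
  have [|P [hP lP]] := IH a; last first.
    by exists P; split=> // i /ltnW; apply: lP.
  have r0 j : root x j = 0.
    by apply: (expr_eq0_dom (n := p ^ j)); rewrite root_pow.
  move=> y; rewrite ha /=; split=> [[j [b]]|h]; first by rewrite r0 mul0r subr0.
  by exists 0%N, 0; rewrite mulr0 subr0.
have [P [hP lP]] := IH (root_ideal xs) (in_root_ideal xs).
have ha' (y : A) : y \in a <-> exists j b, y - root x j * b \in root_ideal xs.
  by rewrite ha /=; split=> -[j [b h]]; exists j, b; apply/in_root_ideal.
have tf (V : lmodType A) : flat_cg_tf V -> xi_torsion_free (root x) V.
  by move=> [_ _ dV] j v /dV[/root_eq0|].
apply: (@flat_step _ _ _ p_gt1 (rootE x) _ _ (@root_ideal_radical xs) ha'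
  _ _ _ tf _ _ hP lP).
  by move=> V hV; apply: flat_cg_tf_xi => //; apply: tf.
exact: flat_cg_tf_prod.
Qed.

Theorem free_resolution xs (a : ideal A) :
    (forall y : A, y \in a <-> root_sum xs y) ->
  exists P : resolution (quot_mod a),
    (forall i, based (res_mod P i)) /\ res_length_le P (2 * size xs).
Proof.
elim: xs a => [|x xs IH] a ha.
  have [P [hP lP]] := zero_ideal_res ha; exists P; split=> // i.
  rewrite hP; apply: zero_res_modP; [exact: based_ring|exact: based_zero].
have [P [hP lP]] := IH (root_ideal xs) (in_root_ideal xs).
have ha' (y : A) : y \in a <-> exists j b, y - root x j * b \in root_ideal xs.
  rewrite ha /=; split=> -[j [b h]]; exists j, b; exact/in_root_ideal.
rewrite mulnS.
apply: (free_step p_gt1 (rootE x) (@root_ideal_radical xs) ha' _ _ hP lP).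
  exact: based_finsupp.
exact: based_prod.
Qed.

End PerfectDomain.

(** * The perfect closure of a local domain *)

Section PerfectClosureDomain.
Variables (R : idomainType) (p : nat) (charRp : p \in [pchar R]).

Local Notation Rinf := (perfect_closure charRp).

Lemma pc_inS n x : pc_in charRp n.+1 x ^+ p = pc_in charRp n x.
Proof. by rewrite -rmorphXn -(pFrobenius_autE charRp); apply: pc_in_Frob. Qed.

Lemma pc_in_pow n x : pc_in charRp n x ^+ (p ^ n) = pc_in charRp 0 x.
Proof. by elim: n => [|n IH]; rewrite ?expr1 // expnS exprM pc_inS. Qed.

Lemma pc_in_eq0 n x : pc_in charRp n x = 0 -> x = 0.
Proof.
rewrite -(rmorph0 (pc_in charRp 0)) => /pc_in_eq[k [l [_ /=]]].
rewrite iter_Frob0; elim: k x => [//|k IH] x; rewrite iterSr => /IH /eqP.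
by rewrite pFrobenius_autE expf_eq0 => /andP[_ /eqP].
Qed.

(** Two elements of the perfect closure have a common level n, where their
product is taken in R. *)
Lemma perfect_closure_dom (x y : Rinf) : x * y = 0 -> x = 0 \/ y = 0.
Proof.
have [n [u [v [-> ->]]]] := pc_in2 x y.
rewrite -rmorphM => /pc_in_eq0/eqP; rewrite mulf_eq0 => /orP[]/eqP->.
  by left; rewrite rmorph0.
by right; rewrite rmorph0.
Qed.

Lemma perfect_closure_root (x : Rinf) : exists y, y ^+ p = x.
Proof.
have [n [u ->]] := pc_in_surj x.
by exists (pc_in charRp n.+1 u); apply: pc_inS.
Qed.

Lemma contract_prop (a : ideal Rinf) :
  submod_prop (fun x : R^o => pc_in charRp 0 x \in a).
Proof.
split=> [|c u v ua va]; first by rewrite rmorph0; apply: ideal_0.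
by rewrite rmorphD rmorphM; apply: ideal_add => //; apply: ideal_mulr.
Qed.

Definition contract (a : ideal Rinf) : ideal R := Submod (contract_prop a).

Lemma in_contract a x : x \in contract a <-> pc_in charRp 0 x \in a.
Proof. exact: (in_Submod (contract_prop a) x). Qed.

Lemma contract_radical a : radical_ideal a -> radical_ideal (contract a).
Proof.
move=> arad x n /in_contract; rewrite rmorphXn => /arad h; exact/in_contract.
Qed.

(** An element y of level n has y^(p^n) in R, so a radical ideal is determined
by its contraction; [radical_generators] applies to that contraction, and the
contraction of the radical ideal [root_ideal] contains it. *)
Lemma radical_ideal_root_sum (m : ideal R) d (r : Rinf -> Rinf)
    (rE : forall x, r x ^+ p = x) (a : ideal Rinf) :
    noetherian R -> local_ring m -> krull_dim R d -> radical_ideal a ->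
    (1 : Rinf) \notin a ->
  exists2 xs : seq Rinf, size xs = d &
    forall y : Rinf, y \in a <-> root_sum r xs y.
Proof.
move=> noeth lm dimR arad a1.
have charA : p \in [pchar Rinf] := rmorph_pchar (pc_in charRp 0) charRp.
have c1 : (1 : R) \notin contract a.
  by apply: contra a1 => /in_contract; rewrite rmorph1.
have [s [sd sa] hs] := radical_generators noeth lm dimR c1.
pose xs := [seq pc_in charRp 0 x | x <- s].
exists xs => [|y]; first by rewrite size_map.
split; last first.
  apply: (root_sum_min rE arad).
  by move=> _ /mapP[x /sa /in_contract xa ->].
have [n [u ->]] := pc_in_surj y => ya.
pose J : ideal Rinf := root_ideal charA rE xs.
have Jrad : radical_ideal J :=
  @root_ideal_radical _ _ charA perfect_closure_dom r rE xs.
have /hs aJ := contract_radical Jrad.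
apply/(in_root_ideal charA rE)/(Jrad _ (p ^ n)%N); rewrite pc_in_pow.
apply/in_contract/aJ => [x xs_x|].
  apply/in_contract/(in_root_ideal charA rE)/(mem_root_ideal charA rE).
  exact: (map_f (pc_in charRp 0) xs_x).
apply/in_contract; rewrite -(pc_in_pow n).
have : (0 < p ^ n)%N by rewrite expn_gt0 (prime_gt0 (pcharf_prime charRp)).
by case: (p ^ n)%N => // k _; rewrite exprSr; apply: ideal_mulr.
Qed.

End PerfectClosureDomain.

Theorem proposition3p15 (R : idomainType) (m : ideal R) (p : nat)
    (charRp : p \in [pchar R]) (d : nat)
    (noethR : noetherian R) (localR : local_ring m) (dimR : krull_dim R d) :
  (forall a : ideal (perfect_closure charRp), radical_ideal a ->
     exists P : resolution (quot_mod a),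
       (forall i, free_mod (res_mod P i) /\ countably_generated (res_mod P i))
       /\ res_length_le P (2 * d)) /\
  (forall a : ideal (perfect_closure charRp), radical_ideal a ->
     exists P : resolution (quot_mod a),
       (forall i, flat_mod (res_mod P i) /\ countably_generated (res_mod P i))
       /\ res_length_le P d).
Proof.
have charA : p \in [pchar perfect_closure charRp] :=
  rmorph_pchar (pc_in charRp 0) charRp.
have /choice[r rE] := @perfect_closure_root R p charRp.
have dom := @perfect_closure_dom R p charRp.
split=> a arad; have [a1|a1] := boolP ((1 : perfect_closure charRp) \in a).
- have [P P0] := unit_ideal_res a1; exists P; split=> [i|i _]; last exact: P0.
  by split; [exact/based_free/based_zero | exact/count_genP/count_gen_zero].
- have [xs xsd ha] := radical_ideal_root_sum rE noethR localR dimR arad a1.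
  have [P [hP lP]] := free_resolution charA dom rE ha.
  exists P; split=> [i|]; last by rewrite -xsd.
  by split; [exact: based_free | exact/count_genP/based_count_gen].
- have [P P0] := unit_ideal_res a1; exists P; split=> [i|i _]; last exact: P0.
  by split; [exact/flat_zero | exact/count_genP/count_gen_zero].
- have [xs xsd ha] := radical_ideal_root_sum rE noethR localR dimR arad a1.
  have [P [hP lP]] := flat_resolution charA dom rE ha.
  exists P; split=> [i|]; last by rewrite -xsd.
  by have [flatP /count_genP] := hP i.
Qed.
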